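(* Let $n\ge 1$. Let $F_{2n}$ be the set of fixed-point-free involutions in $S_{2n}$, partially ordered by the order inherited from the opposite Bruhat order on $S_{2n}$, and let $\mathcal{A}=\mathcal{A}_e\cup\mathcal{A}_o\subseteq F_{2n}$, where: - $\mathcal{A}_e$ is the set of all $\iota\in F_{2n}$ having exactly one symplectic essential box, the rank condition at that box being an even number $2r$; - $\mathcal{A}_o$ is the set of all $\iota\in F_{2n}$ having exactly two symplectic essential boxes, one at a position $(p,p+1)$ with even rank condition $2r$, and one in row $p+1$ with odd rank condition $2r+1$. Then $\mathcal{A}$ contains all basic elements of the poset $F_{2n}$. Hence the corresponding set of orbit closures $\{\overline{Y_\iota}:\iota\in\mathcal{A}\}$ contains all basic elements of the poset of closures of $Sp_n$-orbits on the flag manifold $\mathcal{F}\ell(\mathbb{C}^{2n})$, ordered by containment.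
   Context: Bruhat order on $S_m$: $\pi$ covers $\rho$ if $\pi=\rho t_{ij}$ for a transposition $t_{ij}$ and $\ell(\pi)=\ell(\rho)+1$ (so the identity is the minimum). The opposite Bruhat order reverses all relations. With $r_{ij}(\pi)=\#\{k\le i:\pi(k)\le j\}$, one has $\pi\le\rho$ in the opposite Bruhat order if and only if $r_{ij}(\pi)\le r_{ij}(\rho)$ for all $i,j$. A fixed-point-free involution is $\iota\in S_{2n}$ with $\iota^2=\mathrm{id}$ and $\iota(i)\neq i$ for all $i$. Basic elements: the basic elements of a (finite) poset are the elements from which all other elements can be found by taking unique greatest lower bounds of larger basic elements. That is, an element $x$ is basic if it is not the greatest lower bound (in the poset) of any set of elements strictly larger than $x$; the empty set is allowed, its greatest lower bound being the maximum element if one exists. Equivalently, a subset of a finite poset contains all basic elements if and only if every element of the poset is the greatest lower bound of some subset of it. Rothe diagram of $\pi\in S_m$: the set of cells $(i,j)$ (row $i$, column $j$) with $\pi(i)>j$ and $\pi^{-1}(j)>i$; i.e. in the permutation matrix with $1$'s at $(k,\pi(k))$, cross out all cells weakly below and weakly to the right of each $1$ (in its column and row), and keep the remaining cells. The symplectic diagram of $\iota\in F_{2n}$ is the set of cells $(i,j)$ of the Rothe diagram of $\iota$ with $i<j$. A symplectic essential box of $\iota$ is a cell $(i,j)$ of the symplectic diagram such that neither $(i+1,j)$ nor $(i,j+1)$ is in the symplectic diagram. The rank condition at $(i,j)$ is the number $r_{ij}(\iota)$. Orbits: $J$ is the $2n\times 2n$ block diagonal matrix with diagonal blocks $\left(\begin{smallmatrix}0&1\\-1&0\end{smallmatrix}\right)$;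 $Sp_n=\{M\in GL_{2n}(\mathbb{C}):MJM^T=J\}$; $B_-$ is the group of invertible lower triangular matrices; $\mathcal{F}\ell(\mathbb{C}^{2n})=B_-\backslash GL_{2n}(\mathbb{C})$, on which $Sp_n$ acts by right multiplication (by inverses). The orbits are indexed by $F_{2n}$: $Y_\iota$ is the set of (classes of) $M\in GL_{2n}(\mathbb{C})$ such that $MJM^T$ lies in the orbit, under $b\cdot N=bNb^T$ ($b\in B_-$), of an antisymmetric matrix whose nonzero entries are exactly at the positions $(i,\iota(i))$. *)

(* Defs.v *)
From HB Require Import structures.
From mathcomp Require Import all_boot all_order all_algebra all_fingroup.
From mathcomp Require Import generic_quotient.
From mathcomp Require Import complex.
From mathcomp Require Import all_classical all_reals all_analysis.

Set Implicit Arguments.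
Unset Strict Implicit.
Unset Printing Implicit Defensive.

Import Order.TTheory GRing.Theory Num.Theory.
Import numFieldNormedType.Exports.

(** Rows, columns and permuted points are numbered from 0: the ordinal [i]
    stands for the 1-based index [i + 1]. *)

Section Bruhat.
Variable m : nat.
Implicit Types pi rho : 'S_m.

Definition perm_length pi : nat :=
  #|[set ij : 'I_m * 'I_m | (ij.1 < ij.2)%N && (pi ij.2 < pi ij.1)%N]%SET|.

(** Products in ['S_m] are composed from left to right, so the function
    composite [rho o t_ij] is [tperm i j * rho]. *)
Definition bruhat_cover : rel 'S_m := fun rho pi =>
  [exists i : 'I_m, exists j : 'I_m, (i != j) && (pi == (tperm i j * rho)%g)]
  && (perm_length pi == (perm_length rho).+1).

(** [connect] is the reflexive transitive closure. *)
Definition opp_bruhat pi rho : Prop := connect bruhat_cover rho pi.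

Definition fpf_involution pi : Prop :=
  (pi * pi = 1)%g /\ forall i, pi i != i.

(** [r_ij], with 0-based [i] and [j]. *)
Definition rank_cond pi (i j : 'I_m) : nat :=
  #|[set k : 'I_m | (k <= i)%N && (pi k <= j)%N]%SET|.

Definition rothe_diagram pi : {set 'I_m * 'I_m} :=
  [set c : 'I_m * 'I_m | (c.2 < pi c.1)%N && (c.1 < (pi^-1)%g c.2)%N]%SET.

Definition symplectic_diagram pi : {set 'I_m * 'I_m} :=
  [set c in rothe_diagram pi | (c.1 < c.2)%N]%SET.

(** Cells lying outside the [m x m] grid are not in the diagram. *)
Definition symplectic_essential_boxes pi : {set 'I_m * 'I_m} :=
  [set c in symplectic_diagram pi |
    [forall i : 'I_m,
       (val i == c.1.+1) ==> ((i, c.2) \notin symplectic_diagram pi)] &&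
    [forall j : 'I_m,
       (val j == c.2.+1) ==> ((c.1, j) \notin symplectic_diagram pi)]]%SET.

Definition A_even pi : Prop :=
  fpf_involution pi /\
  exists (i j : 'I_m) (r : nat),
    symplectic_essential_boxes pi = [set (i, j)]%SET /\
    rank_cond pi i j = (2 * r)%N.

(** The boxes [(p, q)] and [(q, k)] are distinct since [q = p + 1]. *)
Definition A_odd pi : Prop :=
  fpf_involution pi /\
  exists (p q k : 'I_m) (r : nat),
    [/\ val q = p.+1,
        symplectic_essential_boxes pi = [set (p, q); (q, k)]%SET,
        rank_cond pi p q = (2 * r)%N &
        rank_cond pi q k = (2 * r).+1].

Definition A_all pi : Prop := A_even pi \/ A_odd pi.

End Bruhat.

Local Open Scope classical_set_scope.
Local Open Scope ring_scope.
Local Open Scope quotient_scope.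

(** Basic elements of the poset with carrier [P] and order [le]. *)
Section Basic.
Variables (T : Type) (P : set T) (le : T -> T -> Prop).

Definition is_glb (S : set T) (x : T) : Prop :=
  [/\ P x, forall y, S y -> le x y
    & forall z, P z -> (forall y, S y -> le z y) -> le z x].

Definition basic (x : T) : Prop :=
  P x /\
  ~ exists S : set T,
      [/\ S `<=` P, forall y, S y -> le x y /\ x <> y & is_glb S x].

End Basic.

Section Flags.
Variable R : realType.

(** The complex numbers; the type [numClosedFieldType] is what gives access to
    the topology induced by the modulus. *)
Definition CC : numClosedFieldType := R[i]%C.

Variable m : nat.

Definition GL_set : set 'M[CC]_m := [set M | M \in unitmx].

(** [GL_m] with the subspace topology of the space of matrices. *)
Definition GL := set_type GL_set.
HB.instance Definition _ := Topological.on GL.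

Definition Borel_minus : set 'M[CC]_m :=
  [set b | b \in unitmx /\ is_trig_mx b].

Definition same_flag : rel GL := fun M N =>
  `[< exists2 b, Borel_minus b & val N = b *m val M >].

Lemma is_trig_mulmx (a b : 'M[CC]_m) :
  is_trig_mx a -> is_trig_mx b -> is_trig_mx (a *m b).
Proof.
move=> /is_trig_mxP ha /is_trig_mxP hb; apply/is_trig_mxP => i j ij.
rewrite mxE big1 // => k _; case: (ltnP i k) => [ik|ki].
  by rewrite ha // mul0r.
by rewrite hb ?mulr0 //; exact: leq_ltn_trans ij.
Qed.

Lemma is_trig_invmx (b : 'M[CC]_m) :
  b \in unitmx -> is_trig_mx b -> is_trig_mx (invmx b).
Proof.
move=> ub tb; have /is_trig_mxP hb := tb.
have bii i : b i i != 0.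
  by move: ub; rewrite unitmxE unitfE det_trig // => /prodf_neq0; exact.
apply/is_trig_mxP => i j; have [k] := ubnP (val i).
elim: k i => // k IH i; rewrite ltnS => ik ij.
have := congr1 (fun A : 'M[CC]_m => A i j) (mulmxV ub).
rewrite !mxE (negbTE (_ : i != j)); last by rewrite neq_ltn ij.
rewrite (bigD1 i) //= big1 ?addr0 => [/eqP|l li].
  by rewrite mulf_eq0 (negbTE (bii i)) => /eqP.
case: (ltngtP i l) => [il|il|/val_inj e]; last by rewrite e eqxx in li.
  by rewrite hb ?mul0r.
by rewrite IH ?mulr0 //; [exact: leq_trans ik | exact: ltn_trans ij].
Qed.

Lemma same_flag_refl : reflexive same_flag.
Proof.
move=> M; apply/asboolP; exists 1%:M; last by rewrite mul1mx.
by split; [exact: unitmx1 | exact: scalar_mx_is_trig].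
Qed.

Lemma same_flag_trans : transitive same_flag.
Proof.
move=> N M P /asboolP[b [ub tb] eN] /asboolP[c [uc tc] eP].
apply/asboolP; exists (c *m b); last by rewrite eP eN mulmxA.
by split; [rewrite unitmx_mul uc ub | exact: is_trig_mulmx].
Qed.

Lemma same_flag_sym : symmetric same_flag.
Proof.
suff H M N : same_flag M N -> same_flag N M by move=> M N; apply/idP/idP; exact: H.
move=> /asboolP[b [ub tb] eN]; apply/asboolP; exists (invmx b).
  by split; [rewrite unitmx_inv | exact: is_trig_invmx].
by rewrite eN mulKmx.
Qed.

Canonical same_flag_equiv :=
  EquivRel same_flag same_flag_refl same_flag_sym same_flag_trans.

(** The flag manifold [B_- \ GL_m] with the quotient topology. *)
Definition Flag := quotient_topology {eq_quot same_flag_equiv}.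
HB.instance Definition _ := Topological.on Flag.
HB.instance Definition _ := Quotient.on Flag.

Definition flag (M : GL) : Flag := \pi_Flag M.

Lemma GL_divP (M g : GL) : val M *m invmx (val g) \in GL_set.
Proof.
rewrite inE /GL_set /= unitmx_mul unitmx_inv.
by rewrite (set_valP M : _ \in unitmx) (set_valP g : _ \in unitmx).
Qed.

Definition GL_div (M g : GL) : GL := SigSub (GL_divP M g).

(** The action of [GL_m] by right multiplication by inverses. *)
Definition flag_act (g : GL) (x : Flag) : Flag := flag (GL_div (repr x) g).

Lemma flag_actE (g M : GL) : flag_act g (flag M) = flag (GL_div M g).
Proof.
apply/eqquotP => /=; rewrite /flag.
have /eqquotP/asboolP[b hb e] : \pi_Flag (repr (\pi_Flag M)) = \pi_Flag M.
  exact: reprK.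
by apply/asboolP; exists b => //=; rewrite mulmxA -e.
Qed.

(** Block diagonal with [m / 2] blocks [(0, 1; -1, 0)]; used for even [m]. *)
Definition Jmx : 'M[CC]_m :=
  \matrix_(i, j) (((~~ odd i && (val j == i.+1))%:R)
                  - ((~~ odd j && (val i == j.+1))%:R)).

Definition Sp : set GL :=
  [set g | val g *m Jmx *m (val g)^T = Jmx].

Definition Sp_orbit (x : Flag) : set Flag := [set flag_act g x | g in Sp].

Definition Sp_orbit_closures : set (set Flag) :=
  [set closure (Sp_orbit x) | x in [set: Flag]].

Definition antisym_of_support (iota : 'S_m) (N : 'M[CC]_m) : Prop :=
  N^T = - N /\ forall i j, (N i j != 0) = (j == iota i).

Definition Y (iota : 'S_m) : set Flag :=
  [set flag M | M in [set M : GL |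
     exists b N, [/\ Borel_minus b, antisym_of_support iota N &
       val M *m Jmx *m (val M)^T = b *m N *m b^T]]].

End Flags.

Arguments Flag R m : clear implicits.
Arguments Sp_orbit_closures R m : clear implicits.
Arguments Y R {m} iota.

(* Main.v *)
Require Import Defs.
From mathcomp Require Import all_boot all_order all_algebra all_fingroup.
From mathcomp Require Import zify ring generic_quotient complex.
From mathcomp Require Import all_classical all_reals all_analysis.

(** Encode [iota] by its rank function [rk iota p q], the number of [k < p] with
    [iota k < q]; it is the rank of the upper left [p x q] corner of an
    antisymmetric matrix with support [iota].  If [(a, b)] is a cell of the
    symplectic diagram, [x = iota a] and [y = iota b], then replacing the pairs
    [a-x], [b-y] by [a-b], [x-y] raises [iota]: the rank grows by one on the box
    [[a, y[ x [b, x[] and on its transpose, and nowhere else.  These moves generate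
    the order on fixed-point-free involutions, which is therefore the order of
    rank functions; and a violated rank condition is violated at an essential box.

    If [iota] is basic, some [z] lies below everything above [iota] but not below
    [iota], so [z] violates the rank condition of [iota] at an essential box
    [(i, j)], and each of the above moves must change the rank at [(i, j)].  This
    leaves room for no other essential box than [(i - 1, i)], which is present
    exactly when the rank at [(i, j)] is odd.

    On the flag side, symmetric Gaussian elimination brings [M J M^T] to a matrix
    supported on an involution, which identifies the orbits with the [Y iota].
    A move at [(a, b)] is realised by the curve [(1 + s E_ay) M], which lies in the
    orbit of the new involution for [s <> 0] and tends to [M]; conversely corner
    ranks of [M J M^T] can only drop in the limit.  So containment of closures is
    the order of rank functions as well. *)
Set Implicit Arguments.
Unset Strict Implicit.
Unset Printing Implicit Defensive.

Local Open Scope classical_set_scope.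

(** * Rank functions and the Bruhat order *)

Definition rk m (pi : 'S_m) (p q : nat) : nat :=
  #|[pred k : 'I_m | (k < p)%N && (pi k < q)%N]|.

Lemma rank_condE m (pi : 'S_m) (i j : 'I_m) :
  rank_cond pi i j = rk pi i.+1 j.+1.
Proof. by rewrite /rank_cond cardsE; apply: eq_card => k; rewrite !inE !ltnS. Qed.

Lemma rk_sum m (pi : 'S_m) p q :
  rk pi p q = \sum_(k < m) ((k < p) && (pi k < q)).
Proof. by rewrite /rk -sum1_card big_mkcond; apply: eq_bigr => k _; rewrite inE. Qed.

Lemma rk0 m (pi : 'S_m) q : rk pi 0 q = 0.
Proof. by rewrite rk_sum big1. Qed.

Lemma rkS m (pi : 'S_m) (p : 'I_m) q :
  rk pi p.+1 q = rk pi p q + (pi p < q).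
Proof.
rewrite !rk_sum (bigD1 p) //= [in RHS](bigD1 p) //= ltnn ltnS leqnn add0n addnC.
congr (_ + _); apply: eq_bigr => k kp; congr (nat_of_bool (_ && _)).
by rewrite ltnS leq_eqVlt val_eqE (negbTE kp).
Qed.

Lemma rk_inv m (pi : 'S_m) p q : rk pi p q = rk (pi^-1)%g q p.
Proof.
rewrite !rk_sum (reindex_inj (@perm_inj _ (pi^-1)%g)); apply: eq_bigr => k _.
by rewrite permKV andbC.
Qed.

Lemma rk_mono m (pi : 'S_m) p p' q : p <= p' -> rk pi p q <= rk pi p' q.
Proof.
move=> pp; apply/subset_leq_card/fintype.subsetP => k; rewrite !inE.
by case/andP => kp ->; rewrite (leq_trans kp pp).
Qed.

(** Only the summands of [i] and [j] change: the two entries pass to the opposite corners of the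
    rectangle they span. *)
Lemma rk_tperm m (rho : 'S_m) (i j : 'I_m) p q :
  i < j -> rho i < rho j ->
  rk rho p q = rk (tperm i j * rho)%g p q
             + ((i < p <= j) && (rho i < q <= rho j)).
Proof.
move=> ij rij; have nij : j != i by rewrite -val_eqE /=; lia.
rewrite !rk_sum (bigD1 i) //= (bigD1 j) //= [in RHS](bigD1 i) //=.
rewrite [in X in _ = _ + X + _](bigD1 j) //=.
rewrite !permM tpermL tpermR.
under [in RHS]eq_bigr => k /andP[k1 k2] do rewrite permM tpermD 1?eq_sym //.
by lia.
Qed.


(** [r] orients every pair [x], [f x], and [f] reverses the orientation, so it matches one half of
    [A] with the other. *)
Lemma even_card_fpf (T : finType) (f : T -> T) (A : {pred T}) (r : rel T) :
  involutive f -> {in A, forall x, f x \in A} ->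
  {in A, forall x, r x (f x) (+) r (f x) x} -> ~~ odd #|A|.
Proof.
move=> fK fA rf; rewrite -(cardID [pred x | r x (f x)] A).
suff -> : #|[predD A & [pred x | r x (f x)]]| = #|[predI A & [pred x | r x (f x)]]|.
  by rewrite addnn odd_double.
rewrite -(fintype.card_image (inv_inj fK)); apply: eq_card => x.
apply/fintype.imageP/andP => [[y]|[xA]].
  rewrite !inE => /andP[/= ry yA] ->; split; first exact: fA.
  by rewrite /= fK; move: (rf y yA); rewrite (negbTE ry).
rewrite inE => rx; exists (f x); rewrite ?fK // !inE fK fA // andbT.
by move: (rf x xA); rewrite rx.
Qed.

(** * Rematching two pairs of a fixed-point-free involution *)

Section Rematch.
Variable m : nat.
Implicit Types (iota kappa pi rho : 'S_m) (a b i j k : 'I_m).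

Lemma fpf_involutionP iota :
  fpf_involution iota -> involutive iota /\ (forall i, iota i != i :> nat).
Proof.
case=> sq nf; split=> [k|]; last exact: nf.
by rewrite -permM sq perm1.
Qed.

Lemma fpf_inv iota : fpf_involution iota -> (iota^-1)%g = iota.
Proof. by case=> sq _; apply: (mulgI iota); rewrite mulgV sq. Qed.

Lemma rk_sym iota p q : fpf_involution iota -> rk iota p q = rk iota q p.
Proof. by move=> fi; rewrite rk_inv fpf_inv. Qed.

Lemma odd_rk iota p : fpf_involution iota -> ~~ odd (rk iota p p).
Proof.
move=> /fpf_involutionP[iK nf].
apply: (@even_card_fpf _ iota _ (fun x y => x < y)) => // k; rewrite !inE.
  by rewrite iK andbC.
by move: (nf k) => /= nk _; case: ltngtP nk.
Qed.

Definition cell iota a b := [&& a < b, b < iota a & a < iota b].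

Lemma mem_symplectic_diagram iota a b : fpf_involution iota ->
  ((a, b) \in symplectic_diagram iota) = cell iota a b.
Proof.
move=> fi; rewrite !inE /= fpf_inv // /cell.
by rewrite -andbA andbC -andbA; do !bool_congr.
Qed.

(** Written with two transpositions, so that ranks and Bruhat order can be followed one
    transposition at a time; [rematchE] lists the values. *)
Definition rematch iota a b : 'S_m :=
  (tperm b (iota a) * (tperm a (iota b) * iota))%g.

Lemma cell_distinct iota a b : fpf_involution iota -> cell iota a b ->
  [/\ iota a != b, iota b != a, a != b & iota a != iota b].
Proof.
move=> /fpf_involutionP[iK nf] /and3P[ab bx ay].
have nab : a != b by rewrite -val_eqE /= neq_ltn ab.
split=> //; last by rewrite (inj_eq perm_inj).
  by rewrite -val_eqE /= neq_ltn bx orbT.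
by rewrite -val_eqE /= neq_ltn ay orbT.
Qed.

Lemma rematchE iota a b k : fpf_involution iota -> cell iota a b ->
  rematch iota a b k =
  if k == a then b else if k == b then a else
  if k == iota a then iota b else if k == iota b then iota a else iota k.
Proof.
move=> fi c; have [xb ya ab xy] := cell_distinct fi c.
have [bx ay ba yx] : [/\ b != iota a, a != iota b, b != a & iota b != iota a].
  by split; rewrite eq_sym.
have [iK nf] := fpf_involutionP fi.
have nx : forall i, iota i != i by exact: nf.
have nx' : forall i, i != iota i by move=> i; rewrite eq_sym.
rewrite /rematch !permM.
have [->|ka] := eqVneq k a; first by rewrite (tpermD (z := a)) // tpermL iK.
have [->|kb] := eqVneq k b.
  by rewrite tpermL tpermD ?iK.
have [->|kx] := eqVneq k (iota a).
  by rewrite tpermR tpermD.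
rewrite [tperm b _ _]tpermD 1?eq_sym //.
have [->|ky] := eqVneq k (iota b); first by rewrite tpermR.
by rewrite tpermD 1?eq_sym.
Qed.

Lemma rematch_fpf iota a b : fpf_involution iota -> cell iota a b ->
  fpf_involution (rematch iota a b).
Proof.
move=> fi c; have [xb ya ab xy] := cell_distinct fi c.
have [bx ay ba yx] : [/\ b != iota a, a != iota b, b != a & iota b != iota a].
  by split; rewrite eq_sym.
have [iK nf] := fpf_involutionP fi.
have nx : forall i, iota i != i by exact: nf.
have nx' : forall i, i != iota i by move=> i; rewrite eq_sym.
split=> [|k].
  apply/permP => k; rewrite permM perm1 [rematch iota a b k]rematchE //.
  have [->|ka] := eqVneq k a; first by rewrite rematchE // eqxx eq_sym (negbTE ab).
  have [->|kb] := eqVneq k b; first by rewrite rematchE // eqxx.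
  have [->|kx] := eqVneq k (iota a).
    rewrite rematchE // (negbTE ya) (negbTE (nx b)) eq_sym (negbTE xy) eqxx //.
  have [->|ky] := eqVneq k (iota b).
    by rewrite rematchE // (negbTE xb) (negbTE (nx a)) eqxx.
  rewrite rematchE // !(can2_eq iK iK) (negbTE kx) (negbTE ky) !iK.
  by rewrite (negbTE ka) (negbTE kb).
rewrite rematchE //; have [->|ka] := eqVneq k a; first by [].
have [->|kb] := eqVneq k b; first by [].
have [->|kx] := eqVneq k (iota a); first by [].
by have [->|ky] := eqVneq k (iota b).
Qed.

(* The two transpositions act on the entries [(a, x), (y, b)] and on their
   transposes. *)
Lemma rematch_steps iota a b : fpf_involution iota -> cell iota a b ->
  let x := iota a in let y := iota b in
  let rho := (tperm a y * iota)%g in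
  [/\ iota = (tperm a y * rho)%g, rho a = b, rho y = x,
      rho = (tperm b x * rematch iota a b)%g &
      rematch iota a b b = a /\ rematch iota a b x = y].
Proof.
move=> fi c x y rho; have [xb ya ab xy] := cell_distinct fi c.
have [bx ay ba yx] : [/\ b != iota a, a != iota b, b != a & iota b != iota a].
  by split; rewrite eq_sym.
have [iK nf] := fpf_involutionP fi.
have nx : forall i, iota i != i by exact: nf.
have nx' : forall i, i != iota i by move=> i; rewrite eq_sym.
rewrite /rho /rematch !mulgA !tperm2 !mul1g !permM tpermL tpermR iK; split => //.
by rewrite tpermL tpermR tpermD ?tpermD ?iK.
Qed.

(** The two boxes may overlap: where [p] and [q] both exceed [b] and are at most [iota a] and
    [iota b], the rank rises by two. *)
Lemma rk_rematch iota a b p q : fpf_involution iota -> cell iota a b ->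
  rk (rematch iota a b) p q = rk iota p q
    + ((a < p <= iota b) && (b < q <= iota a))
    + ((b < p <= iota a) && (a < q <= iota b)).
Proof.
move=> fi c; have [e1 ra ry e2 [kb kx]] := rematch_steps fi c.
case/and3P: c => ab bx ay.
set rho := (tperm a (iota b) * iota)%g in e1 ra ry e2.
have := @rk_tperm m rho a (iota b) p q ay; rewrite ra ry -e1 => /(_ bx) E1.
have := @rk_tperm m (rematch iota a b) b (iota a) p q bx.
by rewrite kb kx -e2 => /(_ ay) ->; rewrite E1.
Qed.

End Rematch.

(** * A rematching that stays below a given larger involution *)

Section Exists.
Variable m : nat.
Implicit Types (iota kappa pi rho : 'S_m) (a b c i j k x y : 'I_m).

Definition rk_le pi rho := forall p q, rk pi p q <= rk rho p q.

Definition band pi (p c q : nat) :=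
  #|[pred k : 'I_m | (k < p) && (c <= pi k < q)]|.

Lemma rk_band pi (p c q : nat) : c <= q -> rk pi p q = rk pi p c + band pi p c q.
Proof.
move=> cq; rewrite /rk -(cardID [pred k | pi k < c] [pred k : 'I_m | (k < p) && (pi k < q)]).
congr (_ + _); apply: eq_card => k; rewrite !inE /=; lia.
Qed.

(** Otherwise the corner with [a.+1] rows and [(iota a).+1] columns counts row [a] for [iota] but
    not for [kappa], while the earlier rows agree. *)
Lemma rk_le_first_diff iota kappa a : rk_le iota kappa ->
  (forall k, k < a -> iota k = kappa k) -> iota a != kappa a ->
  kappa a < iota a.
Proof.
move=> le same ne; rewrite ltn_neqAle eq_sym ne /= leqNgt; apply/negP => lt.
have := le a.+1 (iota a).+1; rewrite !rkS.
suff -> : rk iota a (iota a).+1 = rk kappa a (iota a).+1 by lia.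
by apply: eq_card => k; rewrite !inE; case: ltnP => //= ka; rewrite same.
Qed.

(** Let [a] be the first row where the involutions differ. Among the later rows whose column is at
    least [kappa a] and less than [iota a], the first one is called [y], and [b] is its partner; the
    minimality of [y] keeps the new ranks below those of [kappa]. *)
Lemma exists_rematch iota kappa : fpf_involution iota -> fpf_involution kappa ->
  rk_le iota kappa -> iota != kappa ->
  exists a b, cell iota a b /\ rk_le (rematch iota a b) kappa.
Proof.
move=> fi fk le ne; have [iK nfi] := fpf_involutionP fi.
have [kK nfk] := fpf_involutionP fk.
have [a0 ha0] : exists k, iota k != kappa k.
  apply/existsP; apply: contraNT ne; rewrite negb_exists => /forallP h.
  by apply/eqP/permP => k; apply/eqP; have := h k; rewrite negbK.
have [a ha amin] := @arg_minnP _ a0 (fun k => iota k != kappa k) val ha0.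
have same k : k < a -> iota k = kappa k.
  by move=> ka; apply/eqP; apply: contraLR ka => /amin /=; rewrite -leqNgt.
have ltk := rk_le_first_diff le same ha.
set c := kappa a in ha ltk; set x := iota a in ha ltk.
have kc : kappa c = a by rewrite /c kK.
have ac : a < c.
  have := nfk a; rewrite /= -/c neq_ltn => /orP[ca|//].
  by move: ha; rewrite /x -kc -(same c ca) iK eqxx.
have aic : a < iota c.
  rewrite ltn_neqAle eq_sym leqNgt; apply/andP; split; last first.
    apply/negP => h; have := same _ h; rewrite iK => e.
    have : kappa c = iota c by rewrite {1}e kK.
    by rewrite kc => e'; rewrite -e' ltnn in h.
  apply/eqP => /val_inj e; move: ltk; rewrite /x -e iK ltnn //.
have y0 : (a < iota c) && (c <= iota (iota c) < x) by rewrite aic iK leqnn ltk.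
have [y /and3P[ay cy yx] ymin] :=
  @arg_minnP _ (iota c) (fun k => (a < k) && (c <= iota k < x)) val y0.
pose b := iota y; have yb : y = iota b by rewrite /b iK.
have ab : a < b by apply: leq_trans cy.
have cl : cell iota a b by rewrite /cell ab -yb ay yx.
have early k : k < y -> c <= iota k -> iota k < x -> k < a.
  move=> ky ck kx; rewrite ltnNge leq_eqVlt; apply/negP => /predU1P[e|ak].
    by move: kx; rewrite -(val_inj e) /x ltnn.
  by have := ymin k; rewrite /= ak ck kx => /(_ isT); rewrite leqNgt ky.
(* Above row [y], the entries of [iota] in columns [c] to [q - 1] lie in rows before [a], so [kappa]
   has them too; it also has [(a, c)]. *)
have strict p q : a < p <= y -> c < q <= x -> rk iota p q < rk kappa p q.
  move=> /andP[ap py] /andP[cq qx].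
  rewrite (rk_band iota p (ltnW cq)) (rk_band kappa p (ltnW cq)) -addnS.
  apply: leq_add => //; apply: proper_card; apply/properP; split.
    apply/fintype.subsetP => k; rewrite !inE => /and3P[kp ck kq].
    rewrite -(same k) ?kp ?ck //; apply: (early k) => //.
      exact: leq_trans py.
    exact: leq_trans qx.
  by exists a; rewrite !inE -/c -/x; lia.
(* Where the boxes overlap a gap of two is needed. At [(p, p)] both ranks are even, so the strict
   gap is at least two, and the columns [p] to [q - 1] do not lessen it. *)
have overlap p q : b < p -> p <= y -> p <= q <= x -> rk iota p q + 2 <= rk kappa p q.
  move=> bp py /andP[pq qx].
  have ap : a < p by apply: ltn_trans bp.
  have cp : c < p by apply: leq_ltn_trans bp.
  rewrite (rk_band iota p pq) (rk_band kappa p pq) addnAC; apply: leq_add.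
    have := strict p p; rewrite ap py cp (leq_trans pq qx) => /(_ isT isT).
    by have := odd_rk p fi; have := odd_rk p fk; lia.
  apply/subset_leq_card/fintype.subsetP => k; rewrite !inE => /and3P[kp ck kq].
  rewrite -(same k) ?kp ?ck //; apply: (early k); first exact: leq_trans py.
    by apply: leq_trans ck; apply: ltnW.
  exact: leq_trans qx.
exists a, b; split=> // p q; rewrite rk_rematch // -yb -/x.
have strict' := strict q p; have overlap' := overlap q p.
have le0 := le p q; have S1 := strict p q; have O1 := overlap p q.
rewrite !(rk_sym q p) // in strict' overlap'.
have bc : c <= b by [].
by case: (ltnP a p) (ltnP p y.+1) (ltnP b q) (ltnP q x.+1) (ltnP b p) (ltnP p x.+1)
   (ltnP a q) (ltnP q y.+1); lia.
Qed.

End Exists.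

(** * Length, covers and comparison of the two orders *)

Section Bruhat.
Variable m : nat.
Implicit Types (iota kappa pi rho : 'S_m) (a b c i j k x y : 'I_m).

Lemma sum_pairs_split (f : 'I_m -> 'I_m -> nat) i j : j != i ->
  \sum_p \sum_q f p q = f i i + f i j + f j i + f j j
    + \sum_(k | (k != i) && (k != j)) (f i k + f k i + f j k + f k j)
    + \sum_(p | (p != i) && (p != j)) \sum_(q | (q != i) && (q != j)) f p q.
Proof.
move=> ji; have split (g : 'I_m -> nat) :
  \sum_k g k = g i + g j + \sum_(k | (k != i) && (k != j)) g k.
  by rewrite (bigD1 i) //= (bigD1 j) //= addnA.
under eq_bigr => p _ do rewrite split.
by rewrite split !big_split /=; lia.
Qed.

Lemma perm_length_sum pi :
  perm_length pi = \sum_(p < m) \sum_(q < m) ((p < q) && (pi q < pi p)).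
Proof.
rewrite pair_big /= /perm_length -sum1_card big_mkcond /=.
by apply: eq_bigr => -[p q] _; rewrite inE.
Qed.

(** For each third index [k], the number of inversions with [i] and [j] is unchanged, because no
    entry lies inside the rectangle; the pair [i], [j] supplies the new inversion. *)
Lemma perm_length_tperm rho i j : i < j -> rho i < rho j ->
  (forall k, i < k < j -> ~~ (rho i < rho k < rho j)) ->
  perm_length (tperm i j * rho)%g = (perm_length rho).+1.
Proof.
move=> ij rij nb; have ji : j != i by rewrite -val_eqE /=; lia.
rewrite !perm_length_sum !(sum_pairs_split _ ji) !permM tpermL tpermR.
have e : \sum_(k < m | (k != i) && (k != j)) \sum_(q < m | (q != i) && (q != j))
     ((k < q) && ((tperm i j * rho)%g q < (tperm i j * rho)%g k)) =
  \sum_(k < m | (k != i) && (k != j)) \sum_(q < m | (q != i) && (q != j))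
     ((k < q) && (rho q < rho k)).
  apply: eq_bigr => p /andP[pi pj]; apply: eq_bigr => q /andP[qi qj].
  by rewrite !permM !tpermD // eq_sym.
rewrite e; under [in LHS]eq_bigr => k /andP[ki kj].
  rewrite permM tpermD 1?eq_sym //.
  have -> : (i < k) && (rho k < rho j) + (k < i) && (rho j < rho k) +
    (j < k) && (rho k < rho i) + (k < j) && (rho i < rho k) =
    (i < k) && (rho k < rho i) + (k < i) && (rho i < rho k) +
    (j < k) && (rho k < rho j) + (k < j) && (rho j < rho k).
    have r1 : rho k != rho i :> nat by rewrite (inj_eq val_inj) (inj_eq perm_inj).
    have r2 : rho k != rho j :> nat by rewrite (inj_eq val_inj) (inj_eq perm_inj).
    have k1 : k != i :> nat by [].
    have k2 : k != j :> nat by [].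
    by have := nb k; lia.
  over.
by rewrite /= -[RHS]addSn; congr (_ + _); rewrite -[RHS]addSn; congr (_ + _); lia.
Qed.

(** An entry [k] inside the rectangle gives [t_ij = t_ik t_kj t_ik], three length-raising
    transpositions of closer positions; without such an entry the transposition is a cover. *)
Lemma opp_bruhat_tperm rho i j : i < j -> rho i < rho j ->
  opp_bruhat (tperm i j * rho)%g rho.
Proof.
have [n] := ubnP (j - i); elim: n => // n IH in rho i j *.
rewrite ltnS => jin ij rij.
have nij : i != j by rewrite -val_eqE neq_ltn ij.
have [/existsP[k /andP[/andP[ik kj] /andP[rik rkj]]]|] :=
  boolP [exists k : 'I_m, (i < k < j) && (rho i < rho k < rho j)].
  have nik : i != k by rewrite -val_eqE neq_ltn ik.
  have nkj : k != j by rewrite -val_eqE neq_ltn kj.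
  have -> : tperm i j = (tperm i k * (tperm k j * tperm i k))%g.
    rewrite -{1}(tpermV i k) -[RHS]/(_ ^ _)%g tpermJ tpermR tpermD //.
  have h1 : opp_bruhat (tperm i k * rho)%g rho by apply: IH => //; lia.
  have h2 : opp_bruhat (tperm k j * (tperm i k * rho))%g (tperm i k * rho)%g.
    by apply: IH => //; rewrite ?permM ?tpermR ?(tpermD nij nkj) //; lia.
  have h3 : opp_bruhat (tperm i k * (tperm k j * (tperm i k * rho)))%g
      (tperm k j * (tperm i k * rho))%g.
    apply: IH => //; first lia.
    rewrite !permM tpermL (tpermD (z := i)) 1?eq_sym // tpermL.
    by rewrite tpermD.
  by rewrite -!mulgA; apply: connect_trans h1 (connect_trans h2 h3).
move=> /existsPn nb; apply: connect1; rewrite /bruhat_cover; apply/andP; split.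
  by apply/existsP; exists i; apply/existsP; exists j; rewrite nij eqxx.
by rewrite perm_length_tperm // => k ikj; have := nb k; rewrite ikj.
Qed.

Lemma rk_le_trans pi rho kappa : rk_le pi rho -> rk_le rho kappa -> rk_le pi kappa.
Proof. by move=> h1 h2 p q; apply: leq_trans (h1 p q) (h2 p q). Qed.

Lemma connect_perm_length rho pi : connect (@bruhat_cover m) rho pi ->
  perm_length rho <= perm_length pi.
Proof.
case/connectP => s + ->; elim: s rho => //= pi' s IH rho /andP[/andP[_ /eqP e]].
by move=> /IH; apply: leq_trans; rewrite e.
Qed.

(** If [rho] had an inversion at [i], [j], it would be reached upwards from [pi] and be at least as
    long. So the length condition forces the case of [rk_tperm]. *)
Lemma bruhat_cover_rk_le rho pi : bruhat_cover rho pi -> rk_le pi rho.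
Proof.
case/andP => /existsP[i /existsP[j /andP[nij /eqP->]]] /eqP len p q.
wlog ij : i j nij len / i < j.
  move=> H; move: (nij); rewrite -val_eqE neq_ltn => /orP[|ji]; first exact: H.
  by rewrite tpermC; apply: H => //; rewrite 1?eq_sym 1?tpermC.
have [rij|rji] := ltnP (rho i) (rho j); first by rewrite (@rk_tperm _ rho i j) ?leq_addr.
have := @opp_bruhat_tperm (tperm i j * rho)%g i j ij.
rewrite !permM tpermL tpermR mulgA tperm2 mul1g ltn_neqAle rji andbT.
rewrite (inj_eq val_inj) (inj_eq perm_inj) eq_sym nij => /(_ isT).
by move=> /connect_perm_length; rewrite len ltnn.
Qed.

Lemma opp_bruhat_rk_le pi rho : opp_bruhat pi rho -> rk_le pi rho.
Proof.
case/connectP => s + ->; elim: s rho => [|pi' s IH] rho; first by move=> _ p q.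
by case/andP => c /IH h; apply: rk_le_trans h (bruhat_cover_rk_le c).
Qed.

Lemma opp_bruhat_rematch iota a b : fpf_involution iota -> cell iota a b ->
  opp_bruhat iota (rematch iota a b).
Proof.
move=> fi c; have [e1 ra ry e2 [kb kx]] := rematch_steps fi c.
case/and3P: c => ab bx ay.
apply: (@connect_trans _ _ (tperm a (iota b) * iota)%g).
  by rewrite e2; apply: opp_bruhat_tperm; rewrite ?kb ?kx.
have := @opp_bruhat_tperm (tperm a (iota b) * iota)%g _ _ ay.
by rewrite ra ry -e1; apply.
Qed.

Lemma rk_rematch_lt iota a b : fpf_involution iota -> cell iota a b ->
  rk iota a.+1 b.+1 < rk (rematch iota a b) a.+1 b.+1.
Proof. by move=> fi c; rewrite rk_rematch //; case/and3P: c; lia. Qed.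

Lemma rk_le_rematch iota a b : fpf_involution iota -> cell iota a b ->
  rk_le iota (rematch iota a b).
Proof. by move=> fi c p q; rewrite rk_rematch // -addnA leq_addr. Qed.

(** Induction downwards from [kappa]: each rematching raises the total rank [S], which is bounded by
    that of [kappa]. It serves for the Bruhat order, for the nonemptiness of [Y iota] and for
    closures. *)
Lemma rk_le_ind (P : 'S_m -> Prop) kappa : fpf_involution kappa -> P kappa ->
  (forall iota a b, fpf_involution iota -> cell iota a b ->
     rk_le (rematch iota a b) kappa -> P (rematch iota a b) -> P iota) ->
  forall iota, fpf_involution iota -> rk_le iota kappa -> P iota.
Proof.
move=> fk Pk step iota.
pose S (pi : 'S_m) := \sum_(p : 'I_m) \sum_(q : 'I_m) rk pi p.+1 q.+1.
have [n] := ubnP (S kappa - S iota); elim: n iota => // n IH iota.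
rewrite ltnS => Sn fi le; have [->//|ne] := eqVneq iota kappa.
have [a [b [c lec]]] := exists_rematch fi fk le ne.
have f' := rematch_fpf fi c; apply: (step _ a b) => //; apply: IH => //.
have mono pi rho : rk_le pi rho -> S pi <= S rho.
  by move=> h; do 2![apply: leq_sum => ? _].
have lt : S iota < S (rematch iota a b).
  rewrite /S (bigD1 a) //= [ltnRHS](bigD1 a) //= -addSn leq_add //; last first.
    by do 2![apply: leq_sum => ? _]; apply: rk_le_rematch.
  rewrite (bigD1 b) //= [ltnRHS](bigD1 b) //= -addSn leq_add ?rk_rematch_lt //.
  by apply: leq_sum => ? _; apply: rk_le_rematch.
by have := mono _ _ lec; lia.
Qed.

Lemma opp_bruhatP iota kappa : fpf_involution iota -> fpf_involution kappa ->
  opp_bruhat iota kappa <-> rk_le iota kappa.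
Proof.
move=> fi fk; split; first exact: opp_bruhat_rk_le.
move: fi; apply: (rk_le_ind fk (P := fun pi => opp_bruhat pi kappa)) => {iota}.
  exact: connect0.
move=> iota a b fi c _ h.
exact: connect_trans h (opp_bruhat_rematch fi c).
Qed.

(** Otherwise some rematching of [iota] would lie below [kappa], hence below [iota], although it
    raises a rank. *)
Lemma rk_le_anti iota kappa : fpf_involution iota -> fpf_involution kappa ->
  rk_le iota kappa -> rk_le kappa iota -> iota = kappa.
Proof.
move=> fi fk h1 h2; apply/eqP; apply: contraT => ne.
have [a [b [c h]]] := exists_rematch fi fk h1 ne.
by have := rk_le_trans h h2 a.+1 b.+1; rewrite leqNgt rk_rematch_lt.
Qed.

End Bruhat.

(** * Essential boxes *)

Section Essential.
Variable m : nat.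
Implicit Types (iota kappa pi rho : 'S_m) (a b c i j k x y : 'I_m).

Definition essential iota i j :=
  [/\ cell iota i j,
      forall i', val i' = i.+1 -> ~~ cell iota i' j &
      forall j', val j' = j.+1 -> ~~ cell iota i j'].

Lemma essentialP iota i j : fpf_involution iota ->
  (i, j) \in symplectic_essential_boxes iota <-> essential iota i j.
Proof.
move=> fi; rewrite inE /= !mem_symplectic_diagram //; split.
  case/and3P => c /forallP h1 /forallP h2; split=> // k e.
    by have := h1 k; rewrite e eqxx mem_symplectic_diagram.
  by have := h2 k; rewrite e eqxx mem_symplectic_diagram.
case=> -> h1 h2 /=; apply/andP; split; apply/forallP => k; apply/implyP => /eqP.
  by rewrite mem_symplectic_diagram //; apply: h1.
by rewrite mem_symplectic_diagram //; apply: h2.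
Qed.

Lemma rk_minn pi p q : rk pi p q = rk pi (minn p m) (minn q m).
Proof.
apply: eq_card => k; rewrite !inE.
by have := ltn_ord k; have := ltn_ord (pi k); lia.
Qed.

Lemma rkSr pi i p : fpf_involution pi -> rk pi p i.+1 = rk pi p i + (pi i < p).
Proof. by move=> f; rewrite !(rk_sym p) // rkS. Qed.

Lemma exists_cell_rk_gt iota kappa p q : fpf_involution iota ->
  fpf_involution kappa -> rk iota p q < rk kappa p q ->
  exists i j, cell iota i j /\ rk iota i.+1 j.+1 < rk kappa i.+1 j.+1.
Proof.
move=> fi fk; have [iK nf] := fpf_involutionP fi.
rewrite rk_minn [in ltnRHS]rk_minn.
have := geq_minr q m; have := geq_minr p m.
move: (minn p m) (minn q m) => {}p {}q.
wlog: p q / p <= q.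
  move=> H pm qm; case: (leqP p q) => [|/ltnW] pq; first exact: H.
  by rewrite !(rk_sym p) //; apply: H.
have [n] := ubnP (p + q); elim: n p q => // n IH p q pqn pq pm qm lt.
case: p => [|p] in pqn pq pm lt *; first by rewrite !rk0 in lt.
case: q => [|q] in pqn pq qm lt *; first by [].
have := rkS iota (Ordinal pm) q.+1; have := rkS kappa (Ordinal pm) q.+1.
have := rkSr (Ordinal qm) p.+1 fi; have := rkSr (Ordinal qm) p.+1 fk.
have [e|pneq] := eqVneq p q.
  have := odd_rk p.+1 fi; have := odd_rk p.+1 fk => /= o1 o2 _ _ E1 E2.
  by apply: (IH p q.+1); rewrite -?e in o1 o2 E1 E2 lt *; lia.
have ltpq : p < q by lia.
move=> /= E1 E2 E3 E4.
have [ipq|qip] := ltnP (iota (Ordinal pm)) q.+1.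
  by apply: (IH p q.+1); lia.
have [jqp|pjq] := ltnP (iota (Ordinal qm)) p.+1.
  by apply: (IH p.+1 q); lia.
by exists (Ordinal pm), (Ordinal qm); split=> //; apply/and3P.
Qed.

(** Moving down or right to another cell keeps the rank of [iota] and cannot lower that of [kappa],
    so the violation can be pushed to an essential box. *)
Lemma exists_essential_rk_gt iota kappa : fpf_involution iota ->
  fpf_involution kappa -> ~ rk_le kappa iota ->
  exists i j, essential iota i j /\ rk iota i.+1 j.+1 < rk kappa i.+1 j.+1.
Proof.
move=> fi fk nle.
have [p [q lt]] : exists p q, rk iota p q < rk kappa p q.
  apply: contrapT => h; apply: nle => p q; rewrite leqNgt; apply/negP => lt; apply: h.
  by exists p, q.
have [i [j]] := exists_cell_rk_gt fi fk lt.
have [n] := ubnP (m + m - (i + j)); elim: n i j => // n IH i j ijn [c {}lt].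
have [/existsP[k /andP[/eqP e ck]]|/existsPn h1] :=
  boolP [exists k : 'I_m, (val k == i.+1) && cell iota k j].
  apply: (IH k j); first by have := ltn_ord k; have := ltn_ord j; rewrite /= in e; lia.
  split=> //; apply: leq_trans (rk_mono kappa _ (_ : i.+1 <= k.+1)); last by rewrite /= in e; lia.
  by rewrite rkS; case/and3P: ck => _ kj _; move: e kj => /= ->; lia.
have [/existsP[k /andP[/eqP e ck]]|/existsPn h2] :=
  boolP [exists k : 'I_m, (val k == j.+1) && cell iota i k].
  apply: (IH i k); first by have := ltn_ord k; have := ltn_ord i; rewrite /= in e; lia.
  split=> //; rewrite (rk_sym _ _ fk).
  apply: leq_trans (rk_mono kappa _ (_ : j.+1 <= k.+1)); last by rewrite /= in e; lia.
  rewrite -(rk_sym _ _ fk) (rkSr _ _ fi).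
  by case/and3P: ck => _ _ ki; move: e ki => /= ->; lia.
exists i, j; split=> //; split=> // k e; apply/negP => ck.
  by have := h1 k; rewrite e eqxx ck.
by have := h2 k; rewrite e eqxx ck.
Qed.

(* For an element maximal among those of bounded rank at [(i, j)], every
   rematching must change that rank. *)
Definition critical iota i j := forall a b, cell iota a b ->
  (a <= i < iota b) && (b <= j < iota a) || (b <= i < iota a) && (a <= j < iota b).

End Essential.

(** * Essential boxes of a critical involution *)

Section Critical.
Variable m : nat.
Variables (iota : 'S_m) (i j : 'I_m).
Hypotheses (fi : fpf_involution iota) (crit : critical iota i j).
Hypothesis (essij : essential iota i j).
Implicit Types (a b c k w z : 'I_m).

Let iK : involutive iota. Proof. by case: (fpf_involutionP fi). Qed.
Let nf a : iota a != a :> nat. Proof. by case: (fpf_involutionP fi). Qed.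
Let cij : cell iota i j. Proof. by case: essij. Qed.
Let neq_iota a b : a != b :> nat -> iota a != iota b :> nat.
Proof. by rewrite !(inj_eq val_inj) (inj_eq perm_inj). Qed.

Let eq_iota a b : a = b :> nat -> iota a = iota b :> nat.
Proof. by move=> /val_inj->. Qed.

Lemma exists_succ a b : a < b -> exists c : 'I_m, val c = a.+1.
Proof. by move=> ab; exists (Ordinal (leq_ltn_trans ab (ltn_ord b))). Qed.

(** Otherwise the pairs of the adjacent indices [a] and [a'] could be rematched, changing ranks only
    in row [a] and column [a], where [a < i < j]. *)
Lemma crit_succ a a' : a' = a.+1 :> nat -> a' < i -> iota a != a' :> nat ->
  iota a <= iota a'.
Proof.
move=> e a'i ne; rewrite leqNgt; apply/negP => lt.
have cr1 := crit (a := a) (b := iota a'); have cr2 := crit (a := iota a') (b := a).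
have nea : iota a' != a :> nat by have := neq_iota ne; rewrite iK; lia.
by case/and3P: cij => i1 i2 i3; rewrite /cell !iK in cr1 cr2; lia.
Qed.

(** Two consequences of essentiality are played against [crit]. If [b + 1 < iota a], then
    [iota (b + 1) < a], and rematching the pairs of [b] and [b + 1] changes ranks only in row and
    column [b]. If [a + 1] is less than [b] and [iota b], then [iota (a + 1) < b < iota a], which
    [crit_succ] forbids for [a + 1 < i]. *)
Lemma critical_essential a b : essential iota a b ->
  (a = i /\ b = j) \/ (a.+1 = i /\ b = i).
Proof.
move=> [cab ra cb]; have cr := crit cab.
case/and3P: (cab) => ab bx ay; case/and3P: cij => lij jx iy.
have row a' : val a' = a.+1 -> a' < b -> a' < iota b -> iota a' <= b.
  by move=> e h1 h2; have := ra a' e; rewrite /cell h1 h2 andbT /= -leqNgt.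
have col b' : val b' = b.+1 -> b' < iota a -> iota b' < a.
  move=> e h; have := cb b' e; rewrite /cell h /= /=.
  have : iota b' != a :> nat; last by rewrite /= in e; lia.
  by rewrite -(iK a); apply: neq_iota; lia.
have not_b a' : a' != iota b :> nat -> iota a' != b :> nat.
  by move=> h; rewrite -(iK b); apply: neq_iota.
case/orP: cr => /andP[/andP[c1 c2] /andP[c3 c4]].
  move: c3; rewrite leq_eqVlt => /predU1P[/val_inj bj|bj].
    subst b.
    move: c1; rewrite leq_eqVlt => /predU1P[/val_inj ai|ai]; first by left.
    have [a' ea] := exists_succ ai.
    have := row _ ea; have := not_b a'; have := @crit_succ a a' ea.
    have := @eq_iota a' i; rewrite /= in ea; lia.
  have [b' eb] := exists_succ bj; have wa := col b' eb; rewrite /= in eb.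
  have {}wa : iota b' < a by apply: wa; lia.
  have cr1 := crit (a := iota b') (b := a); rewrite /cell !iK in cr1.
  (* Here [b < j], so [(i, j)] can only be in row [b], that is, [b = i]. *)
  have cr2 := crit (a := iota b') (b := b); rewrite /cell !iK in cr2.
  have ib : i <= b by lia.
  move: c1; rewrite leq_eqVlt => /predU1P[/val_inj ai|ai]; first by subst a; lia.
  have [a' ea] := exists_succ ai.
  have := @crit_succ a a' ea; have row' := row _ ea; have nb := not_b a'; rewrite /= in ea.
  have [a'b|?] := ltnP a' b.
    by have := @eq_iota a' i; lia.
  by move=> _; right; split; [lia | apply: val_inj => /=; lia].
right; have bi : b = i.
  apply: val_inj; apply/eqP; rewrite eqn_leq c1 leqNgt; apply/negP => /= bi.
  have [b' eb] := exists_succ bi; have wa := col b' eb; rewrite /= in eb.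
  (* Here [b < i < j], so neither row [b] nor column [b] contains [(i, j)]. *)
  have cr2 := crit (a := iota b') (b := b); rewrite /cell !iK in cr2.
  by lia.
subst b; split=> //; apply/eqP; rewrite eqn_leq ab leqNgt; apply/negP => /= ai.
have [a' ea] := exists_succ ab.
have := @crit_succ a a' ea; have := row _ ea; have := not_b a'; rewrite /= in ea.
by lia.
Qed.

Lemma boxes_set (B : {set 'I_m * 'I_m}) :
  (forall a b, (a, b) \in B <-> essential iota a b) ->
  symplectic_essential_boxes iota = B.
Proof.
move=> H; apply/finset.setP => -[a b]; apply/idP/idP => [/(essentialP _ _ fi)/H //|].
by move=> /H/(essentialP _ _ fi).
Qed.

(** Row and column [i] add nothing, since [i < j < iota i]. By [odd_rk] the first summand is even,
    so the band decides the parity of the rank condition. *)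
Lemma rk_box : rk iota i.+1 j.+1 = rk iota i i + band iota i.+1 i.+1 j.+1.
Proof.
case/and3P: cij => lij jx iy.
by rewrite (@rk_band _ iota i.+1 i.+1) ?rkS ?(rkSr _ _ fi); lia.
Qed.

Lemma critical_A_even :
  ~~ [exists k : 'I_m, (k <= i) && (i < iota k <= j)] -> A_even iota.
Proof.
move=> /existsPn none; split=> //; case/and3P: cij => lij jx iy.
exists i, j, (rk iota i i)./2; split; last first.
  rewrite rank_condE rk_box (_ : band _ _ _ _ = 0).
    by have := odd_rk i fi; lia.
  by apply: eq_card0 => k; rewrite !inE; have := none k; lia.
apply: boxes_set => a b; rewrite inE; split=> [/eqP[-> ->] //|eab].
have [[-> ->]|[ea eb]] := critical_essential eab; first exact: eqxx.
(* If [(i - 1, i)] were essential, its row would have its entry beyond column [j], and column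
   [i + 1] would have its entry above row [i], contrary to [none]. *)
have [b' eb'] := exists_succ lij.
case: eab => /and3P[ab bx ay] _ /(_ b'); rewrite eb eb' => /(_ erefl).
rewrite /= in eb'; rewrite /cell; have na := none a; have nb := none (iota b').
rewrite iK in nb; have := neq_iota (a := b') (b := iota a); rewrite iK.
by rewrite eb in bx; lia.
Qed.

(** Such a [k] is unique, so the band in [rk_box] has one element and the rank is odd; at
    [(i - 1, i)] the rank is that of the square corner, with the same [r]. *)
Lemma critical_A_odd k : k <= i -> i < iota k <= j -> A_odd iota.
Proof.
move=> ki /andP[ik kj]; split=> //; case/and3P: cij => lij jx iy.
have {}ki : k < i.
  by rewrite ltn_neqAle ki andbT; apply/eqP => /val_inj e; rewrite e in kj; lia.
have pm : i.-1 < m by have := ltn_ord i; lia.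
pose p := Ordinal pm; have ep : p.+1 = i by rewrite /=; lia.
(* Rematching two such rows changes no rank in column [j], as both partners are at most [j]. *)
have uniq k' : (k' <= i) && (i < iota k' <= j) -> k' = k.
  have cr1 := crit (a := k) (b := k'); have cr2 := crit (a := k') (b := k).
  by rewrite /cell in cr1 cr2 => h; apply: val_inj; move=> /=; lia.
have epi : essential iota p i.
  split.
  (* If [k < p], rematching the pairs of [k] and [p] must change the rank at [(i, j)], which forces
     [j < iota p]. *)
  - have cr1 := crit (a := k) (b := p); have cr2 := crit (a := iota p) (b := k).
    rewrite /cell !iK in cr1 cr2 *.
    have n1 := @eq_iota i (iota p); have n2 := @eq_iota k (iota p).
    have n3 := @eq_iota k p; have np := nf p; rewrite !iK in n1 n2.
    have [/val_inj e|ne] := eqVneq (val k) (val p); first by subst k; lia.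
    by rewrite -!/(nat_of_ord _) in ne; lia.
  - by move=> i' e; rewrite /cell; rewrite /= in e; lia.
  (* A cell [(p, i + 1)] would make [(k, i + 1)] a cell whose rematching leaves the rank at [(i, j)]
     alone. *)
  - move=> j' e; rewrite /cell; rewrite /= in e.
    have cr1 := crit (a := k) (b := j'); rewrite /cell in cr1.
    by have n3 := @eq_iota (iota k) j'; rewrite !iK in n3; lia.
exists p, i, j, (rk iota i i)./2; split=> //.
- apply: boxes_set => a b; rewrite !inE; split=> [/orP[]/eqP[-> ->] //|eab].
  have [[-> ->]|[ea ->]] := critical_essential eab; first by rewrite eqxx orbT.
  by apply/orP; left; rewrite xpair_eqE eqxx andbT -val_eqE /=; lia.
- rewrite rank_condE ep (rkSr _ _ fi); have := odd_rk i fi; lia.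
- rewrite rank_condE rk_box (_ : band _ _ _ _ = 1).
    by have := odd_rk i fi; lia.
  apply: (@fintype.eq_card1 _ k) => k'; rewrite !inE; apply/idP/eqP => [h|->]; last lia.
  by apply: uniq; lia.
Qed.

Lemma critical_A_all : A_all iota.
Proof.
have [/existsP[k /andP[ki kj]]|none] :=
  boolP [exists k : 'I_m, (k <= i) && (i < iota k <= j)].
  by right; apply: critical_A_odd ki kj.
by left; apply: critical_A_even.
Qed.

End Critical.

Lemma basic_A_all m (iota : 'S_m) :
  basic [set kappa : 'S_m | fpf_involution kappa] (@opp_bruhat m) iota ->
  A_all iota.
Proof.
case=> fi nglb.
(* All elements strictly above [iota]: as [iota] is not their greatest lower bound, some lower bound
   [z] is not below [iota]. *)
pose S := [set y | fpf_involution y /\ (opp_bruhat iota y /\ iota <> y)].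
have [z [fz zS nz]] : exists z, [/\ fpf_involution z,
    forall y, S y -> opp_bruhat z y & ~ opp_bruhat z iota].
  apply: contrapT => nex; apply: nglb; exists S; split=> [y []//|y []//|].
  split=> // [y [_ []]//|z fz zS]; apply: contrapT => nz.
  by apply: nex; exists z.
have [|i [j [eij lt]]] := @exists_essential_rk_gt m iota z fi fz.
  by move/(opp_bruhatP fz fi).
apply: (@critical_A_all m iota i j) => // a b c.
have f' := rematch_fpf fi c.
have Sy : S (rematch iota a b).
  split=> //; split; first exact: opp_bruhat_rematch.
  by move=> e; have := rk_rematch_lt fi c; rewrite -e ltnn.
have := opp_bruhat_rk_le (zS _ Sy) i.+1 j.+1.
by rewrite rk_rematch // !ltnS; move: lt; case: orP => //; lia.
Qed.

(** * Orbits of the symplectic group *)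

Import Order.TTheory GRing.Theory Num.Theory.

(** * Symmetric elimination by lower triangular congruence *)

Section Congruence.
Local Open Scope ring_scope.
Variables (R : realType) (m : nat).
Local Notation M_m := 'M[CC R]_m.
Implicit Types (N b : M_m) (i j k l a c : 'I_m) (u : 'I_m -> CC R).

Definition Bcong N N' := exists2 b, Borel_minus b & N' = b *m N *m b^T.

Lemma Bcong_refl N : Bcong N N.
Proof.
exists 1%:M; last by rewrite trmx1 mul1mx mulmx1.
by split; [exact: unitmx1 | exact: scalar_mx_is_trig].
Qed.

Lemma Bcong_trans N1 N2 N3 : Bcong N1 N2 -> Bcong N2 N3 -> Bcong N1 N3.
Proof.
case=> b [ub tb] -> [b' [ub' tb'] ->]; exists (b' *m b).
  by split; [rewrite unitmx_mul ub' | exact: is_trig_mulmx].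
by rewrite trmx_mul !mulmxA.
Qed.

Lemma Bcong_sym N N' : Bcong N N' -> Bcong N' N.
Proof.
case=> b [ub tb] ->; exists (invmx b).
  by split; [rewrite unitmx_inv | exact: is_trig_invmx].
by rewrite trmx_inv !mulmxA mulmxK ?unitmx_tr // mulVmx // mul1mx.
Qed.

Definition antisym N := N^T = - N.

Lemma antisymE N i j : antisym N -> N i j = - N j i.
Proof. by move=> /matrixP/(_ j i); rewrite !mxE. Qed.

Lemma antisym_diag N i : antisym N -> N i i = 0.
Proof.
by move=> /(antisymE i i)/eqP; rewrite -subr_eq0 opprK -mulr2n mulrn_eq0 => /eqP.
Qed.

Lemma antisym_congr N b : antisym N -> antisym (b *m N *m b^T).
Proof.
by rewrite /antisym => aN; rewrite !trmx_mul trmxK aN mulNmx mulmxN mulmxA.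
Qed.

Lemma Bcong_antisym N N' : Bcong N N' -> antisym N -> antisym N'.
Proof. by case=> b _ -> aN; apply: antisym_congr. Qed.

(** The congruence of an antisymmetric [N] by the shear [1 + u e_k^T]; the term quadratic in [u] is
    absent because [N k k] is zero. *)
Definition elim_mx N k u : M_m :=
  \matrix_(i, j) (N i j + u i * N k j + N i k * u j).

Lemma elim_mxE N k u : antisym N -> let b := 1%:M + \matrix_(i, j) (u i *+ (j == k)) in
  b *m N *m b^T = elim_mx N k u.
Proof.
move=> aN /=; set U := (X in 1%:M + X).
have UN : U *m N = \matrix_(i, j) (u i * N k j).
  apply/matrixP => i j; rewrite !mxE (bigD1 k) //= mxE eqxx mulr1n big1 ?addr0 //.
  by move=> l /negbTE lk; rewrite mxE lk mulr0n mul0r.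
have NU : N *m U^T = \matrix_(i, j) (N i k * u j).
  apply/matrixP => i j; rewrite !mxE (bigD1 k) //= !mxE eqxx mulr1n big1 ?addr0 //.
  by move=> l /negbTE lk; rewrite !mxE lk mulr0n mulr0.
rewrite raddfD /= trmx1 mulmxDl mul1mx mulmxDr mulmx1 mulmxDl NU.
have -> : U *m N *m U^T = 0.
  rewrite -mulmxA NU; apply/matrixP => i j; rewrite !mxE big1 // => l _.
  rewrite !mxE; have [->|] := eqVneq l k; last by rewrite mulr0n mul0r.
  by rewrite antisym_diag // mul0r mulr0.
by apply/matrixP => i j; rewrite UN !mxE addr0.
Qed.

Lemma Bcong_elim N k u : antisym N -> (forall i, (i <= k)%N -> u i = 0) ->
  Bcong N (elim_mx N k u).
Proof.
move=> aN u0; rewrite -elim_mxE //; set b := 1%:M + _.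
exists b => //; have tb : is_trig_mx b.
  apply/is_trig_mxP => i j ij; rewrite !mxE -val_eqE /= (ltn_eqF ij) mulr0n add0r.
  by have [jk|] := eqVneq j k; rewrite ?mulr0n // u0 // -jk ltnW.
split=> //; rewrite /= unitmxE det_trig // big1 ?unitr1 // => i _.
rewrite !mxE eqxx; have [ik|] := eqVneq i k; last by rewrite mulr0n addr0.
by rewrite u0 ?ik // mul0rn addr0.
Qed.

Definition matched N k c := [/\ N k c != 0, forall l, l != c -> N k l = 0 &
  forall l, l != k -> N c l = 0].

Lemma matched_sym N k c : antisym N -> matched N k c -> matched N c k.
Proof. by move=> aN [h1 h2 h3]; split; rewrite // antisymE // oppr_eq0. Qed.

Lemma matched_elim N k u i j : matched N i j -> u i = 0 -> u j = 0 ->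
  N i k = 0 -> N j k = 0 -> matched (elim_mx N k u) i j.
Proof.
move=> [h1 h2 h3] ui uj ik jk; split=> [|l|l]; rewrite mxE ?ui ?uj ?ik ?jk.
- by rewrite !mul0r !addr0.
- by rewrite !mul0r !addr0; apply: h2.
- by rewrite !mul0r !addr0; apply: h3.
Qed.

(** The pivot is the first nonzero entry of row [a]. Multiples of a row are added only to later
    rows, so the congruences are lower triangular, and they spare the pairs already matched. *)
Lemma matched_row N a : antisym N -> N \in unitmx ->
  (forall k, (k < a)%N -> exists c, matched N k c) ->
  exists2 N', Bcong N N' & forall k, (k <= a)%N -> exists c, matched N' k c.
Proof.
move=> aN uN early.
have [ma|nma] := pselect (exists c, matched N a c).
  exists N; first exact: Bcong_refl.
  move=> k; rewrite leq_eqVlt => /predU1P[/val_inj->//|]; exact: early.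
have [c0 hc0] : exists c, N a c != 0.
  apply: contrapT => h; move: uN; rewrite unitmxE unitfE (expand_det_row _ a).
  rewrite big1 ?eqxx // => j _; have [->|ne] := eqVneq (N a j) 0; first by rewrite mul0r.
  by case: h; exists j.
have [c hc cmin] := @arg_minnP _ c0 (fun j => N a j != 0) val hc0.
have hca : N c a != 0 by rewrite antisymE // oppr_eq0.
(* A pivot left of the diagonal would belong to a pair matched earlier, and row [a] would be matched
   already. *)
have ac : (a < c)%N.
  rewrite ltn_neqAle leqNgt; apply/andP; split.
    by apply: contraNneq hc => /val_inj <-; rewrite antisym_diag.
  apply/negP => ca; have [c' mc] := early c ca; case: (mc) => _ h _.
  have [e|/negP] := eqVneq a c'; last by move/negP/h => e; rewrite e eqxx in hca.
  by apply: nma; exists c; apply: matched_sym => //; rewrite e.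
have nca : c != a by rewrite -val_eqE /= neq_ltn ac orbT.
have early_neq N' k k' : (k < a)%N -> matched N' k k' -> N' c a != 0 -> k' != c.
  move=> ka [_ _ h] ha; apply: contraNneq ha => e; rewrite -e h //.
  by rewrite -val_eqE /= neq_ltn ka orbT.
(* Column [c] clears row [a] to its right; to its left the row is zero by the choice of [c]. *)
pose u l := if (c < l)%N then - N a l / N a c else 0.
pose N1 := elim_mx N c u.
have B1 : Bcong N N1 by apply: Bcong_elim => // i ic; rewrite /u ltnNge ic.
have aN1 := Bcong_antisym B1 aN.
have ua : u a = 0 by rewrite /u ltnNge (ltnW ac).
have rowa j : N1 a j = if j == c then N a c else 0.
  rewrite mxE ua mul0r addr0 /u; case: ifPn => [cj|].
    by rewrite -val_eqE (gtn_eqF cj) mulrCA divff // mulr1 subrr.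
  rewrite -leqNgt mulr0 addr0; case: eqVneq => [-> //|jc jlec].
  apply/eqP; apply: contraNT jc => /cmin /= cj.
  by rewrite -val_eqE eqn_leq jlec.
have hc1 : N1 a c != 0 by rewrite rowa eqxx.
have hca1 : N1 c a != 0 by rewrite antisymE // oppr_eq0.
have early1 k : (k < a)%N -> exists c', matched N1 k c'.
  move=> ka; have [k' mk] := early k ka; exists k'.
  have kc := early_neq _ _ _ ka mk hca; case: (mk) => _ h1 h2.
  have nak : a != k by rewrite -val_eqE /= neq_ltn ka orbT.
  have nck : c != k by rewrite -val_eqE /= neq_ltn (ltn_trans ka ac) orbT.
  apply: matched_elim => //.
  - by rewrite /u ltnNge ltnW // (ltn_trans ka ac).
  - by rewrite /u antisymE // h2 // oppr0 oppr0 mul0r; case: ifP.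
  - by rewrite h1 // eq_sym.
  - exact: h2.
(* Row [a], reduced to its pivot, clears column [c] below it; the matched rows above have no entry
   in column [c]. *)
pose v l := if (a < l)%N && (l != c) then - N1 l c / N1 a c else 0.
have B2 : Bcong N1 (elim_mx N1 a v).
  by apply: Bcong_elim => // i ic; rewrite /v ltnNge ic.
have aN2 := Bcong_antisym B2 aN1.
have va : v a = 0 by rewrite /v ltnn.
have vc : v c = 0 by rewrite /v eqxx andbF.
exists (elim_mx N1 a v); first exact: Bcong_trans B2.
move=> k; rewrite leq_eqVlt => /predU1P[/val_inj->|ka].
  have rowa2 j : elim_mx N1 a v a j = N1 a j.
    by rewrite mxE va antisym_diag // !mul0r !addr0.
  exists c; split=> [|j|j].
  - by rewrite rowa2.
  - by rewrite rowa2 rowa => /negbTE->.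
  - move=> ja; rewrite antisymE // mxE vc mulr0 addr0 /v.
    case: (ltngtP a j) => [aj|aj|/val_inj e]; last by rewrite e eqxx in ja.
      have [->|jc] /= := eqVneq j c; last by rewrite divfK // subrr oppr0.
      by rewrite mul0r addr0 antisym_diag // oppr0.
    rewrite /= mul0r addr0; have [j' mj] := early1 j aj.
    have := early_neq _ _ _ aj mj hca1; case: mj => _ h _.
    by rewrite eq_sym => /h ->; rewrite oppr0.
have [k' mk] := early1 k ka; exists k'.
have kc := early_neq _ _ _ ka mk hca1; case: (mk) => hk h1 h2.
have nak : a != k by rewrite -val_eqE /= neq_ltn ka orbT.
have nck : c != k by rewrite -val_eqE /= neq_ltn (ltn_trans ka ac) orbT.
apply: matched_elim => //.
- by rewrite /v ltnNge ltnW.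
- by rewrite /v h2 // oppr0 mul0r; case: ifP.
- by rewrite antisymE // rowa eq_sym (negbTE nck) oppr0.
- exact: h2.
Qed.

Lemma Bcong_matched N : antisym N -> N \in unitmx ->
  exists2 N', Bcong N N' & forall k, exists c, matched N' k c.
Proof.
move=> aN uN.
suff H p : exists2 N', Bcong N N' & forall k, (k < p)%N -> exists c, matched N' k c.
  by have [N' B h] := H m; exists N' => // k; apply: h.
elim: p => [|p [N' B h]]; first by exists N => //; apply: Bcong_refl.
have [pm|mp] := ltnP p m; last first.
  by exists N' => // k _; apply: h; apply: leq_trans mp.
have uN' : N' \in unitmx.
  by case: B => b [ub _] ->; rewrite !unitmx_mul unitmx_tr ub uN.
have [|N2 B2 h2] := @matched_row N' (Ordinal pm) (Bcong_antisym B aN) uN'; first by [].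
by exists N2 => //; apply: Bcong_trans B2.
Qed.

Lemma antisym_of_supportP (iota : 'S_m) N : antisym_of_support iota N ->
  fpf_involution iota.
Proof.
case=> aN h; split=> [|i].
  apply/permP => i; rewrite permM perm1; apply/eqP; rewrite eq_sym -h.
  by rewrite (antisymE _ _ aN) oppr_eq0 h.
apply: contraTneq isT => e; have := h i (iota i); rewrite eqxx {1}e.
by rewrite antisym_diag // eqxx.
Qed.

Lemma antisym_support_of_matched N (f : 'I_m -> 'I_m) : antisym N ->
  (forall k, matched N k (f k)) ->
  exists2 iota : 'S_m, antisym_of_support iota N & iota =1 f.
Proof.
move=> aN fP.
have nz k j : (N k j != 0) = (j == f k).
  case: (fP k) => h1 h2 _; apply/idP/eqP => [|->//].
  by apply: contraNeq => /h2 ->.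
have fK : involutive f.
  by move=> k; apply/eqP; rewrite eq_sym -nz antisymE // oppr_eq0 nz.
exists (perm (inv_inj fK)); last by move=> k; rewrite permE.
by split=> // i j; rewrite nz permE.
Qed.

Lemma Bcong_support N : antisym N -> N \in unitmx ->
  exists (iota : 'S_m) N', Bcong N N' /\ antisym_of_support iota N'.
Proof.
move=> aN uN; have [N' B h] := Bcong_matched aN uN.
have [f fP] := choice h.
have [iota sN' _] := antisym_support_of_matched (Bcong_antisym B aN) fP.
by exists iota, N'.
Qed.

End Congruence.

(** * Antisymmetric matrices supported on an involution *)

Section Support.
Local Open Scope ring_scope.
Variables (R : realType) (m : nat).
Local Notation M_m := 'M[CC R]_m.
Implicit Types (N : M_m) (i j k l a b c : 'I_m) (iota : 'S_m).

Lemma support_row iota N k j : antisym_of_support iota N ->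
  N k j = N k (iota k) *+ (j == iota k).
Proof.
case=> _ h; have [->//|jk] := eqVneq j (iota k).
by apply/eqP; rewrite mulr0n -[_ == 0]negbK h jk.
Qed.

Lemma support_neq0 iota N k : antisym_of_support iota N -> N k (iota k) != 0.
Proof. by case=> _ h; rewrite h eqxx. Qed.

Lemma matched_support iota N k : antisym_of_support iota N ->
  matched N k (iota k).
Proof.
move=> sN; have [iK _] := fpf_involutionP (antisym_of_supportP sN).
split=> [|l lk|l lk]; first exact: support_neq0.
  by rewrite (support_row _ _ sN) (negbTE lk).
by rewrite (support_row _ _ sN) iK (negbTE lk).
Qed.

Lemma support_unitmx iota N : antisym_of_support iota N -> N \in unitmx.
Proof.
move=> sN; have [iK _] := fpf_involutionP (antisym_of_supportP sN).
suff: N *m (\matrix_(i, j) ((N j i)^-1 *+ (i == iota j))) = 1%:M.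
  by case/mulmx1_unit.
apply/matrixP => i j; rewrite !mxE (bigD1 (iota i)) //= big1 ?addr0.
  rewrite mxE (inj_eq perm_inj); have [->|] := eqVneq i j; last by rewrite mulr0.
  by rewrite divff // (support_neq0 _ sN).
by move=> l li; rewrite (support_row _ _ sN) (negbTE li) mul0r.
Qed.

Lemma exists_support iota : fpf_involution iota ->
  exists N, antisym_of_support iota N.
Proof.
move=> fi; have [iK nf] := fpf_involutionP fi.
exists (\matrix_(i, j) (if j == iota i then (-1) ^+ (i < j)%N else 0)); split.
  apply/matrixP => i j; rewrite !mxE.
  have -> : (i == iota j) = (j == iota i).
    by rewrite -[j in RHS]iK (inj_eq perm_inj) eq_sym.
  case: eqVneq => [->|_]; last by rewrite oppr0.
  have := nf i; case: ltngtP => // _ _; by rewrite expr0 expr1 ?opprK.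
move=> i j; rewrite mxE; have [_|_] := eqVneq j (iota i); last by rewrite eqxx.
by rewrite signr_eq0.
Qed.

(** Scaling the larger index of each pair gives its entry any nonzero value, and antisymmetry
    settles the transposed entry. *)
Lemma support_Bcong iota N N' : antisym_of_support iota N ->
  antisym_of_support iota N' -> Bcong N N'.
Proof.
move=> sN sN'; have [iK nf] := fpf_involutionP (antisym_of_supportP sN).
have [[aN _] [aN' _]] := (sN, sN').
pose d := \row_i (if (i < iota i)%N then 1 else N' i (iota i) / N i (iota i)).
have d0 i : d 0 i != 0.
  rewrite mxE; case: ifP => _; first exact: oner_neq0.
  by rewrite mulf_neq0 ?invr_neq0 ?(support_neq0 _ sN) ?(support_neq0 _ sN').
exists (diag_mx d).
  split; last exact: diag_mx_is_trig.
  by rewrite /= unitmxE det_diag unitfE; apply/prodf_neq0 => i _.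
rewrite tr_diag_mx mul_mx_diag mul_diag_mx; apply/matrixP => i j; rewrite !mxE.
rewrite (support_row i j sN) (support_row i j sN').
have [->|_] := eqVneq j (iota i); last by rewrite !mulr0n mulr0 mul0r.
have n0 := support_neq0 i sN; rewrite !mulr1n iK.
have := nf i; case: ltngtP => // _ _; last first.
  by rewrite mulr1 divfK.
rewrite mul1r (antisymE (iota i) i aN') (antisymE (iota i) i aN) invrN mulrNN.
by rewrite mulrCA divff ?mulr1.
Qed.

Lemma shear_unitmx k (u : 'I_m -> CC R) : u k = 0 ->
  1%:M + \matrix_(i, j) (u i *+ (j == k)) \in unitmx.
Proof.
move=> uk; set U := (X in 1%:M + X).
have UU : U *m U = 0.
  apply/matrixP => i j; rewrite !mxE big1 // => l _; rewrite !mxE.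
  by have [->|_] := eqVneq l k; rewrite ?uk ?mul0rn ?mulr0 ?mulr0n ?mul0r.
have : (1%:M + U) *m (1%:M - U) = 1%:M.
  by rewrite mulmxDl !mulmxBr !mul1mx mulmx1 UU subr0 subrK.
by case/mulmx1_unit.
Qed.

(** The shear adds [s] times row [iota b] to the earlier row [a], which is not a lower triangular
    operation, and creates an entry at [(a, b)]. With it as pivot, two lower triangular eliminations
    remove the old entries at [(a, iota a)] and [(b, iota b)]. *)
Lemma support_degenerate iota N a b (s : CC R) :
  antisym_of_support iota N -> cell iota a b -> s != 0 ->
  exists2 N', Bcong (elim_mx N (iota b) (fun i => s *+ (i == a))) N'
            & antisym_of_support (rematch iota a b) N'.
Proof.
move=> sN cab s0; have fi := antisym_of_supportP sN; have [aN _] := sN.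
have [xb ya ab xy] := cell_distinct fi cab.
have [iK nf] := fpf_involutionP fi.
have nx i : iota i != i by exact: nf.
case/and3P: (cab) => lab lbx lay.
set x := iota a in xb xy lbx; set y := iota b in ya xy lay *.
set p := N a x; set q := N b y.
have p0 : p != 0 by rewrite /p (support_neq0 _ sN).
have q0 : q != 0 by rewrite /q (support_neq0 _ sN).
have Na j : N a j = p *+ (j == x) by rewrite (support_row _ _ sN).
have Nb j : N b j = q *+ (j == y) by rewrite (support_row _ _ sN).
have Nx j : N x j = - p *+ (j == a).
  by rewrite (support_row _ _ sN) iK -(antisymE _ _ aN).
have Ny j : N y j = - q *+ (j == b).
  by rewrite (support_row _ _ sN) iK -(antisymE _ _ aN).
(* [v] cancels [p] at [(a, x)] against [- s q] at [(a, b)], and [w] cancels [q] at [(b, y)] against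
   [s q] at [(b, a)]. The first elimination also creates [p / s] at [(x, y)]. *)
pose v i := p / (s * q) *+ (i == x).
pose w i := - s^-1 *+ (i == y).
set N1 := elim_mx N y _; pose N2 := elim_mx N1 b v; pose N3 := elim_mx N2 a w.
have aN1 : antisym N1 by rewrite /N1 -elim_mxE //; apply: antisym_congr.
have aN2 : antisym N2 by rewrite /N2 -elim_mxE //; apply: antisym_congr.
have aN3 : antisym N3 by rewrite /N3 -elim_mxE //; apply: antisym_congr.
have B2 : Bcong N1 N2.
  apply: Bcong_elim => // i ib; rewrite /v.
  by have [ix|_] := eqVneq i x; rewrite ?mulr0n //; move: ib lbx; rewrite ix; lia.
have B3 : Bcong N2 N3.
  apply: Bcong_elim => // i ia; rewrite /w.
  by have [iy|_] := eqVneq i y; rewrite ?mulr0n //; move: ia lay; rewrite iy; lia.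
have [bx ay ba yx] : [/\ b != x, a != y, b != a & y != x].
  by split; rewrite eq_sym.
have [nxa nyb nax nby] : [/\ x != a, y != b, a != x & b != y].
  by split; rewrite ?nx // eq_sym nx.
pose simp := (eqxx, negbTE xb, negbTE ya, negbTE ab, negbTE xy, negbTE bx,
  negbTE ay, negbTE ba, negbTE yx, negbTE nxa, negbTE nyb, negbTE nax, negbTE nby,
  mulr0n, mulr1n, mulr0, mul0r, addr0, add0r, oppr0).
have N1a j : N1 a j = p *+ (j == x) - s * q *+ (j == b).
  by rewrite mxE Na Ny !simp Na !simp mulNrn mulrN mulrnAr.
have N1b j : N1 b j = q *+ (j == y) + s * q *+ (j == a).
  by rewrite mxE !Nb !simp mulrnAr mulrC.
have N1x j : N1 x j = - p *+ (j == a) by rewrite mxE !Nx !simp.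
have N1y j : N1 y j = - q *+ (j == b) by rewrite mxE !Ny !simp.
have N2a j : N2 a j = - (s * q) *+ (j == b).
  rewrite mxE !N1a !simp /v mulNrn.
  by have [->|_] := eqVneq j x; rewrite !simp //; field; rewrite s0 q0.
have N2b j : N2 b j = N1 b j by rewrite mxE !N1b /v !simp.
have N2x j : N2 x j = p / s *+ (j == y).
  rewrite mxE !N1x !simp /v N1b !simp.
  have [->|_] := eqVneq j y; rewrite !simp; first by field; rewrite s0 q0.
  by have [_|_] := eqVneq j a; rewrite !simp //; field; rewrite s0 q0.
have N2y j : N2 y j = - q *+ (j == b) - p / s *+ (j == x).
  rewrite mxE !N1y !simp /v !simp; congr (_ + _).
  by have [_|_] := eqVneq j x; rewrite !simp //; field; rewrite s0 q0.
have N3a j : N3 a j = - (s * q) *+ (j == b) by rewrite mxE !N2a /w !simp.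
have N3b j : N3 b j = s * q *+ (j == a).
  rewrite mxE !N2b !N1b /w !simp; have [_|_] := eqVneq j y; rewrite !simp //.
  by field; rewrite s0.
have N3x j : N3 x j = p / s *+ (j == y) by rewrite mxE !N2x /w !simp.
have N3y j : N3 y j = - (p / s) *+ (j == x).
  rewrite mxE !N2y !N2a /w !simp; have [_|_] := eqVneq j b; rewrite !simp.
    by field; rewrite s0.
  by rewrite mulNrn.
have sq0 : s * q != 0 by rewrite mulf_neq0.
have ps0 : p / s != 0 by rewrite mulf_neq0 ?invr_neq0.
have m3 : forall k, matched N3 k (rematch iota a b k).
  have mab : matched N3 a b.
    split=> [|l /negbTE lb|l /negbTE la]; first by rewrite N3a !simp oppr_eq0.
      by rewrite N3a lb.
    by rewrite N3b la.
  have mxy : matched N3 x y.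
    split=> [|l /negbTE lb|l /negbTE la]; first by rewrite N3x !simp.
      by rewrite N3x lb.
    by rewrite N3y la.
  move=> k; rewrite rematchE // -/x -/y.
  have [->//|ka] := eqVneq k a; have [->|kb] := eqVneq k b; first exact: matched_sym.
  have [->//|kx] := eqVneq k x; have [->|ky] := eqVneq k y; first exact: matched_sym.
  have ik l l' : l' = iota l -> k != l' -> (iota k == l) = false.
    by move=> -> /negbTE; rewrite -(inj_eq (@perm_inj _ iota)) iK.
  have ika := ik a x erefl kx; have ikb := ik b y erefl ky.
  have ikx := ik x a (esym (iK a)) ka; have iky := ik y b (esym (iK b)) kb.
  have Nk l : iota k != l -> N k l = 0.
    by move=> /negbTE e; rewrite (support_row _ _ sN) eq_sym e.
  have Nik l : k != l -> N (iota k) l = 0.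
    by move=> /negbTE e; rewrite (support_row _ _ sN) iK eq_sym e.
  have uk : s *+ (k == a) = 0 by rewrite (negbTE ka).
  have uik : s *+ (iota k == a) = 0 by rewrite ika.
  have vk : v k = 0 by rewrite /v (negbTE kx).
  have vik : v (iota k) = 0 by rewrite /v ikx.
  have wk : w k = 0 by rewrite /w (negbTE ky).
  have wik : w (iota k) = 0 by rewrite /w iky.
  have M1 : matched N1 k (iota k).
    apply: matched_elim => //; first exact: matched_support.
      by rewrite Nk ?iky.
    by rewrite Nik.
  have M2 : matched N2 k (iota k).
    case: (M1) => _ h1 h2; apply: matched_elim => //.
      by rewrite h1 // eq_sym ikb.
    by rewrite h2 // eq_sym.
  case: (M2) => _ h1 h2; apply: matched_elim => //.
    by rewrite h1 // eq_sym ika.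
  by rewrite h2 // eq_sym.
have [kappa sN3 e] := antisym_support_of_matched aN3 m3.
exists N3; first exact: Bcong_trans B3.
by have -> : rematch iota a b = kappa by apply/permP => k; rewrite e.
Qed.

End Support.

(** * Symplectic orbits and the sets [Y] *)

Section Orbits.
Local Open Scope ring_scope.
Variables (R : realType) (m : nat).
Local Notation M_m := 'M[CC R]_m.
Local Notation J := (Jmx R m).
Implicit Types (N : M_m) (M g : GL R m) (i j k l a b c : 'I_m) (iota : 'S_m).

Lemma antisym_Jmx : antisym J.
Proof. by apply/matrixP => i j; rewrite !mxE opprB. Qed.

(** The bound leaves no cell in the diagram of [iota0], which makes [iota0] the maximum. *)
Lemma Jmx_support : ~~ odd m -> exists2 iota0 : 'S_m,
  antisym_of_support iota0 J & forall i, (iota0 i <= i.+1)%N.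
Proof.
move=> em.
have ex i : exists c, if odd i then i = c.+1 :> nat else c = i.+1 :> nat.
  have im := ltn_ord i; have [oi|oi] := boolP (odd i).
    have pm : (i.-1 < m)%N by lia.
    by exists (Ordinal pm) => /=; lia.
  have pm : (i.+1 < m)%N by lia.
  by exists (Ordinal pm).
have [f fP] := choice ex.
have [|iota0 s0 e] := @antisym_support_of_matched R m J f antisym_Jmx.
  move=> k; have := fP k; case: ifPn => ok fk.
    have ofk : ~~ odd (f k) by lia.
    have nfk : (f k == k.+1 :> nat) = false by lia.
    split=> [|l lk|l lk]; rewrite mxE ?ok ?(negbTE ofk) /=.
    - by rewrite fk eqxx sub0r oppr_eq0 oner_eq0.
    - have : (k == l.+1 :> nat) = false.
        by rewrite fk eqSS eq_sym; apply: negbTE lk.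
      by move=> ->; rewrite andbF subr0.
    have -> : (val l == (f k).+1) = false by rewrite -fk; apply: negbTE lk.
    have -> : ~~ odd l && (val (f k) == l.+1) = false.
      by apply/negP => /andP[ol /eqP e]; move: ofk; rewrite /= in e; lia.
    by rewrite subr0.
  have ofk : odd (f k) by rewrite fk /= ok.
  split=> [|l lk|l lk]; rewrite mxE ?ok ?ofk /=.
  - by rewrite fk eqxx subr0 oner_eq0.
  - have -> : (val l == k.+1) = false by rewrite -fk; apply: negbTE lk.
    have -> : ~~ odd l && (val k == l.+1) = false.
      by apply/negP => /andP[ol /eqP e]; move: ok; rewrite /= in e; lia.
    by rewrite subr0.
  have -> : ~~ odd l && (val (f k) == l.+1) = false.
    rewrite /= fk eqSS; apply/negP => /andP[_ /eqP e].
    by move: lk; rewrite -val_eqE /= e eqxx.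
  by rewrite subr0.
by exists iota0 => // i; rewrite e; have := fP i; case: ifP; lia.
Qed.

Definition gram M : M_m := val M *m J *m (val M)^T.

Lemma unitmx_GL M : val M \in unitmx.
Proof. exact: (set_valP M). Qed.

Definition toGL (A : M_m) (uA : A \in unitmx) : GL R m := exist _ A (mem_set uA).

Lemma Jmx_unit : ~~ odd m -> J \in unitmx.
Proof. by case/Jmx_support => iota0 s0 _; apply: support_unitmx s0. Qed.

Lemma antisym_gram M : antisym (gram M).
Proof. by apply: antisym_congr; apply: antisym_Jmx. Qed.

Lemma gram_unit M : ~~ odd m -> gram M \in unitmx.
Proof. by move=> em; rewrite !unitmx_mul unitmx_tr unitmx_GL Jmx_unit. Qed.

Lemma flagP M M' : flag M = flag M' <-> exists2 b, Borel_minus b & val M' = b *m val M.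
Proof.
split=> [/eqquotP/asboolP //|h]; apply/eqquotP/asboolP.
exact: h.
Qed.

Lemma flag_gram M M' : flag M = flag M' -> Bcong (gram M) (gram M').
Proof.
by move=> /flagP[b Bb e]; exists b; rewrite // /gram e trmx_mul !mulmxA.
Qed.

Lemma flag_surj (x : Flag R m) : exists M, x = flag M.
Proof. by exists (repr x); rewrite /flag reprK. Qed.

Lemma Y_flagP iota M :
  Y R iota (flag M) <-> exists2 N, antisym_of_support iota N & Bcong N (gram M).
Proof.
split=> [[M' [b [N [Bb sN e]]] eM]|[N sN [b Bb e]]].
  by exists N => //; apply: Bcong_trans (flag_gram eM); exists b.
by exists M => //; exists b, N.
Qed.

(** Induction downwards from [iota0]. There a diagonal scaling suffices; below it,
    [support_degenerate] at [s = 1] is undone by inverting the shear and the triangular factor. *)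
Lemma exists_gram iota N : ~~ odd m -> antisym_of_support iota N ->
  exists M, gram M = N.
Proof.
move=> em; have [iota0 s0 le0] := Jmx_support em.
have f0 := antisym_of_supportP s0.
suff: forall iota, fpf_involution iota -> rk_le iota iota0 ->
    forall N, antisym_of_support iota N -> exists M, gram M = N.
  move=> H sN; have fi := antisym_of_supportP sN; apply: H sN => //.
  apply: contrapT => nle.
  have [i [j [[/and3P[ij ji _] _ _] _]]] := exists_essential_rk_gt f0 fi nle.
  by have := le0 i; lia.
apply: rk_le_ind => // [|{}iota a b fi cab _ IH] {}N sN.
  have [b [ub _] e] := support_Bcong s0 sN.
  by exists (toGL ub); rewrite /gram e.
have [N' [b' [ub' _] e'] sN'] := support_degenerate sN cab (oner_neq0 _).
have [M' e] := IH _ sN'.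
have [xb ya ab xy] := cell_distinct fi cab.
set u := (fun i => 1 *+ (i == a)) in e'.
have uy : u (iota b) = 0 by rewrite /u (negbTE ya).
have us := shear_unitmx uy.
have aN : antisym N := proj1 sN.
rewrite -elim_mxE // in e'; set S := 1%:M + _ in us e'.
have uM : invmx S *m (invmx b' *m val M') \in unitmx.
  by rewrite !unitmx_mul !unitmx_inv us ub' unitmx_GL.
exists (toGL uM); rewrite /gram /= !trmx_mul !trmx_inv !mulmxA.
have -> : invmx S *m invmx b' *m val M' *m J *m (val M')^T =
  invmx S *m invmx b' *m gram M' by rewrite /gram !mulmxA.
rewrite e e' !mulmxA mulmxK ?unitmx_tr // -(mulmxA (invmx S)) mulVmx // mulmx1.
by rewrite mulVmx // mul1mx mulmxK ?unitmx_tr.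
Qed.

Lemma Y_nonempty iota : ~~ odd m -> fpf_involution iota ->
  exists M, Y R iota (flag M).
Proof.
move=> em fi; have [N sN] := exists_support R fi.
have [M e] := exists_gram em sN; exists M; apply/Y_flagP; exists N => //.
by rewrite e; apply: Bcong_refl.
Qed.

Lemma Y_cover (x : Flag R m) : ~~ odd m ->
  exists2 iota : 'S_m, fpf_involution iota & Y R iota x.
Proof.
move=> em; have [M ->] := flag_surj x.
have [iota [N [B sN]]] := Bcong_support (antisym_gram M) (gram_unit M em).
exists iota; first exact: antisym_of_supportP sN.
by apply/Y_flagP; exists N => //; apply: Bcong_sym.
Qed.

(** [gram] is invariant under the symplectic group. Conversely, if [gram M'] is [gram M] transformed
    by [b], then [M'^-1 b M] is symplectic and sends the flag of [M] to that of [M']. *)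
Lemma Sp_orbit_Y iota M : Y R iota (flag M) -> Sp_orbit (flag M) = Y R iota.
Proof.
move=> /[dup] YM /Y_flagP[N sN B]; apply/seteqP; split=> [_ [g Sg <-]|x].
  rewrite flag_actE; apply/Y_flagP; exists N => //.
  suff -> : gram (GL_div M g) = gram M by [].
  have ug := unitmx_GL g; rewrite /gram /= trmx_mul trmx_inv.
  have {2}-> : J = invmx (val g) *m J *m invmx (val g)^T.
    by rewrite -{2}Sg !mulmxA mulVmx // mul1mx mulmxK // unitmx_tr.
  by rewrite !mulmxA.
have [M' ->] := flag_surj x; move=> /Y_flagP[N' sN' B'].
have [b [ub tb] e] : Bcong (gram M) (gram M').
  apply: Bcong_trans (Bcong_sym B) _; apply: Bcong_trans B'.
  exact: support_Bcong sN sN'.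
have [uM uM'] := (unitmx_GL M, unitmx_GL M').
have ug : invmx (val M') *m (b *m val M) \in unitmx.
  by rewrite !unitmx_mul unitmx_inv uM' ub.
exists (toGL ug).
  rewrite /Sp /= !trmx_mul trmx_inv !mulmxA.
  have -> : invmx (val M') *m b *m val M *m J *m (val M)^T *m b^T =
    invmx (val M') *m (gram M') by rewrite e /gram !mulmxA.
  by rewrite /gram !mulmxA mulVmx // mul1mx mulmxK // unitmx_tr.
rewrite flag_actE; apply/flagP; exists b => //=.
rewrite mulmxA -{1}(mulKVmx uM' (b *m val M)).
by rewrite mulmxK.
Qed.

End Orbits.

(** * Orbit closures *)

Import numFieldNormedType.Exports.

(** * Continuity of matrix functions and semicontinuity of rank *)

Section MatrixContinuity.
Local Open Scope ring_scope.
Variables (K : numFieldType) (T : topologicalType).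

Definition mx_continuous p q (f : T -> 'M[K]_(p, q)) :=
  forall i j, continuous (fun x => f x i j).

Lemma mx_continuousP p q (f : T -> 'M[K]_(p, q)) : mx_continuous f -> continuous f.
Proof.
move=> cf x A [P hP sPA].
have H : \near x, forall ij : 'I_p * 'I_q, P ij.1 ij.2 (f x ij.1 ij.2).
  by apply: filter_forall => -[i j]; apply: cf; apply: hP.
by apply: filterS H => y Hy; apply: sPA => i j; apply: (Hy (i, j)).
Qed.

Lemma mx_continuous_cst p q (A : 'M[K]_(p, q)) : mx_continuous (fun=> A).
Proof. by move=> i j x; apply: cvg_cst. Qed.

Lemma mx_continuousM p q r (f : T -> 'M[K]_(p, q)) (g : T -> 'M[K]_(q, r)) :
  mx_continuous f -> mx_continuous g -> mx_continuous (fun x => f x *m g x).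
Proof.
move=> cf cg i j.
rewrite (_ : (fun x => _) = (fun x => \sum_k f x i k * g x k j)); last first.
  by apply/funext => x; rewrite mxE.
apply: continuous_big => [|k _ x]; first exact: add_continuous.
by apply: cvgM; [apply: cf | apply: cg].
Qed.

Lemma mx_continuous_tr p q (f : T -> 'M[K]_(p, q)) :
  mx_continuous f -> mx_continuous (fun x => (f x)^T).
Proof.
move=> cf i j; rewrite (_ : (fun x => _) = (fun x => f x j i)); first exact: cf.
by apply/funext => x; rewrite mxE.
Qed.

Lemma det_continuous p (f : T -> 'M[K]_p) :
  mx_continuous f -> continuous (fun x => \det (f x)).
Proof.
move=> cf; apply: continuous_big => [|s _ x]; first exact: add_continuous.
apply: cvgM; first apply: cvg_cst.
move: x; apply: continuous_big => [|i _]; first exact: mul_continuous.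
exact: cf.
Qed.

(* Compressing to the row and column spaces of [f x] by fixed matrices, the rank
   is detected by one nonvanishing determinant. *)
Lemma open_mxrank_gt p q (f : T -> 'M[K]_(p, q)) r : mx_continuous f ->
  open [set x | (r < \rank (f x))%N].
Proof.
move=> cf; rewrite openE => x /= rx; set A := f x in rx.
pose X := pinvmx (col_base A); pose Z := pinvmx (row_base A).
have XAZ : X *m A *m Z = 1%:M.
  have -> : X *m A *m Z = X *m (col_base A *m row_base A) *m Z by rewrite mulmx_base.
  rewrite mulmxA mulVpmx ?col_base_full // mul1mx.
  by rewrite mulmxVp // row_base_free.
have cdet : continuous (fun y => \det (X *m f y *m Z)).
  apply: det_continuous; apply: mx_continuousM; last exact: mx_continuous_cst.
  by apply: mx_continuousM => //; apply: mx_continuous_cst.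
have o : open [set z : K | z != 0].
  rewrite (_ : [set z : K | _] = ~` [set 0]); last first.
    by apply/seteqP; split=> z /= /eqP.
  apply: closed_openC; apply: accessible_closed_set1; apply: hausdorff_accessible.
  exact: norm_hausdorff.
have nz : nbhs x [set y | \det (X *m f y *m Z) != 0].
  apply: (cdet x [set z : K | z != 0]); apply: open_nbhs_nbhs; split=> //=.
  by rewrite -/A XAZ det1 oner_neq0.
apply: filterS nz => y /= dy; apply: (leq_trans rx).
have /mxrank_unit <- : X *m f y *m Z \in unitmx by rewrite unitmxE unitfE.
exact: leq_trans (mxrankM_maxl _ _) (mxrankM_maxr _ _).
Qed.

Lemma affine_continuous (c d : K) :
  continuous (fun s : K => c + s * d).
Proof.
have h0 : continuous (fun _ : K => c) by exact: cst_continuous.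
move=> s; exact: (@cvgD K K^o _ _ _ _ _ c (s * d) (h0 s) (@mulrr_continuous K d s)).
Qed.

End MatrixContinuity.

(** * Ranks of upper left corners *)

Section Corners.
Local Open Scope ring_scope.
Variables (R : realType) (m : nat).
Local Notation M_m := 'M[CC R]_m.
Implicit Types (N b : M_m) (iota kappa : 'S_m) (p q : nat).

Definition proj_mx p : M_m := diag_mx (\row_(i < m) (i < p)%N%:R).

(** The upper left [p x q] corner, padded with zeros to keep the size [m]. *)
Definition corner p q N := proj_mx p *m N *m proj_mx q.

Lemma proj_trig p b : is_trig_mx b ->
  proj_mx p *m b = proj_mx p *m b *m proj_mx p.
Proof.
move=> /is_trig_mxP tb; apply/matrixP => i j.
rewrite /proj_mx mul_diag_mx mul_mx_diag !mxE.
have [ij|ji] := ltnP i j; first by rewrite tb // mulr0 mul0r.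
have [ip|pi] := ltnP i p; last by rewrite !mul0r.
by rewrite (leq_ltn_trans ji ip) mulr1.
Qed.

Lemma mxrank_sandwich (P Q b c N : M_m) :
  P *m b = P *m b *m P -> c *m Q = Q *m c *m Q ->
  (\rank (P *m (b *m N *m c) *m Q) <= \rank (P *m N *m Q))%N.
Proof.
move=> ePb ecQ.
have -> : P *m (b *m N *m c) *m Q = (P *m b) *m (P *m N *m Q) *m (c *m Q).
  transitivity ((P *m b *m P) *m N *m (Q *m c *m Q)); last by rewrite !mulmxA.
  by rewrite -ePb -ecQ !mulmxA.
exact: leq_trans (mxrankM_maxl _ _) (mxrankM_maxr _ _).
Qed.

Lemma corner_Bcong p q N N' : Bcong N N' ->
  \rank (corner p q N) = \rank (corner p q N').
Proof.
suff le N1 N2 : Bcong N1 N2 -> (\rank (corner p q N2) <= \rank (corner p q N1))%N.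
  move=> B; apply/eqP; rewrite eqn_leq; apply/andP.
  by split; apply: le => //; apply: Bcong_sym.
case=> b [ub tb] ->; rewrite /corner; apply: mxrank_sandwich.
  exact: proj_trig.
have := congr1 trmx (proj_trig q tb).
by rewrite !trmx_mul tr_diag_mx mulmxA.
Qed.

(** Truncation keeps exactly the rows of [N] in [A]; as [N] is invertible, the rank is that of the
    coordinate projection [S^T *m S] onto [A]. *)
Lemma corner_support p q iota N : antisym_of_support iota N ->
  \rank (corner p q N) = rk iota p q.
Proof.
move=> sN; set A := [pred k : 'I_m | (k < p)%N && (iota k < q)%N].
pose S : 'M[CC R]_(#|A|, m) := \matrix_(i, j) (j == enum_val i)%:R.
have SS : S *m S^T = 1%:M.
  apply/matrixP => i j; rewrite !mxE (bigD1 (enum_val i)) //= big1 ?addr0.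
    by rewrite !mxE eqxx mul1r (inj_eq enum_val_inj).
  by move=> k ki; rewrite mxE (negbTE ki) mul0r.
have -> : corner p q N = S^T *m S *m N.
  have -> : S^T *m S = diag_mx (\row_i (i \in A)%:R).
    apply/matrixP => i j; rewrite !mxE.
    under eq_bigr => k _ do rewrite !mxE.
    have [iA|niA] := boolP (i \in A); last first.
      rewrite mul0rn big1 // => k _; case: eqP => [e|_]; last by rewrite mul0r.
      by rewrite e enum_valP in niA.
    rewrite (bigD1 (enum_rank_in iA i)) //= enum_rankK_in // eqxx mul1r eq_sym.
    rewrite big1 ?addr0 // => k ki; case: eqP => [e|_]; last by rewrite mul0r.
    by case/eqP: ki; apply: enum_val_inj; rewrite enum_rankK_in // -e.
  rewrite /corner /proj_mx mul_mx_diag !mul_diag_mx; apply/matrixP => i j; rewrite !mxE.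
  rewrite (support_row _ _ sN) inE; have [->|_] := eqVneq j (iota i); last first.
    by rewrite !mulr0n !mulr0 mul0r.
  by case: (i < p)%N; case: (iota i < q)%N; rewrite ?mul1r ?mulr1 ?mul0r ?mulr0.
have uN := support_unitmx sN.
rewrite mxrankMfree ?row_free_unit // /rk -/A; apply/eqP; rewrite eqn_leq.
rewrite (leq_trans (mxrankM_maxr _ _) (rank_leq_row _)) /=.
have {1}<- : \rank (S *m (S^T *m S) *m S^T) = #|A|.
  by rewrite mulmxA SS mul1mx SS mxrank1.
exact: leq_trans (mxrankM_maxl _ _) (mxrankM_maxr _ _).
Qed.

End Corners.

(** * Containment of orbit closures *)

Section Closures.
Local Open Scope ring_scope.
Variables (R : realType) (m : nat).
Hypothesis even_m : ~~ odd m.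
Local Notation M_m := 'M[CC R]_m.
Implicit Types (N : M_m) (M : GL R m) (iota kappa : 'S_m) (p q : nat).

Lemma val_continuous : mx_continuous (val : GL R m -> M_m).
Proof.
move=> i j x; apply: (@continuous_comp _ _ _ (val : GL R m -> M_m) (fun A : M_m => A i j)).
  exact: initial_continuous.
exact: coord_continuous.
Qed.

Lemma open_flag (V : set (Flag R m)) : open [set M | V (flag M)] -> open V.
Proof. by []. Qed.

Lemma corner_repr M p q :
  \rank (corner p q (gram (repr (flag M)))) = \rank (corner p q (gram M)).
Proof. by apply: corner_Bcong; apply: flag_gram; rewrite /flag reprK. Qed.

Lemma open_corner_rank p q r :
  open [set x : Flag R m | (r < \rank (corner p q (gram (repr x))))%N].
Proof.
apply: open_flag; under eq_set => M do rewrite /= corner_repr.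
apply: open_mxrank_gt; apply: mx_continuousM; last exact: mx_continuous_cst.
apply: mx_continuousM; first exact: mx_continuous_cst.
apply: mx_continuousM; last exact/mx_continuous_tr/val_continuous.
by apply: mx_continuousM; [exact: val_continuous | exact: mx_continuous_cst].
Qed.

Lemma Y_corner iota (x : Flag R m) p q : Y R iota x ->
  \rank (corner p q (gram (repr x))) = rk iota p q.
Proof.
have [M ->] := flag_surj x => /Y_flagP[N sN B].
by rewrite corner_repr -(corner_support p q sN); apply/esym/corner_Bcong.
Qed.

(** A corner rank above [rk kappa p q] is an open condition. If it held on [Y iota], it would hold
    somewhere on [Y kappa], where that rank is constant. *)
Lemma closure_Y_rk_le iota kappa : fpf_involution iota ->
  closure (Y R iota) `<=` closure (Y R kappa) -> rk_le iota kappa.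
Proof.
move=> fi sub p q; have [M YM] := Y_nonempty R even_m fi.
rewrite leqNgt; apply/negP => lt.
have [|x [Yx /=]] := sub _ (subset_closure YM)
    [set x | (rk kappa p q < \rank (corner p q (gram (repr x))))%N].
  apply: open_nbhs_nbhs; split; first exact: open_corner_rank.
  by rewrite /= (Y_corner p q YM).
by rewrite (Y_corner p q Yx) ltnn.
Qed.

Lemma Y_gram iota (x : Flag R m) : Y R iota x ->
  exists2 M, x = flag M & antisym_of_support iota (gram M).
Proof.
have [M ->] := flag_surj x => /Y_flagP[N sN [b [ub tb] e]].
have uM : invmx b *m val M \in unitmx by rewrite unitmx_mul unitmx_inv ub unitmx_GL.
exists (toGL uM).
  apply/flagP; exists (invmx b) => //.
  by split; [rewrite /= unitmx_inv | exact: is_trig_invmx].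
suff -> : gram (toGL uM) = N by [].
rewrite /gram /= trmx_mul trmx_inv !mulmxA.
have -> : invmx b *m val M *m Jmx R m *m (val M)^T = invmx b *m gram M.
  by rewrite /gram !mulmxA.
by rewrite e -(mulmxA b) mulKmx // mulmxK // unitmx_tr.
Qed.

Lemma Y_rematch_closure iota a b : cell iota a b ->
  Y R iota `<=` closure (Y R (rematch iota a b)).
Proof.
move=> cab x /Y_gram[M -> sN]; have fi := antisym_of_supportP sN.
have [xb ya ab xy] := cell_distinct fi cab.
pose u (s : CC R) (i : 'I_m) := s *+ (i == a).
have uy s : u s (iota b) = 0 by rewrite /u (negbTE ya).
pose S s : M_m := 1%:M + \matrix_(i, j) (u s i *+ (j == iota b)).
have uG s : S s *m val M \in unitmx by rewrite unitmx_mul shear_unitmx // unitmx_GL.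
pose G s : GL R m := toGL (uG s).
have G0 : G 0 = M.
  apply: val_inj; rewrite /= (_ : S 0 = 1%:M) ?mul1mx //.
  by apply/matrixP => i j; rewrite !mxE /u !mul0rn addr0.
have cG : continuous G.
  apply: continuous_comp_initial; apply: mx_continuousP.
  apply: mx_continuousM; last exact: mx_continuous_cst.
  move=> i j; rewrite (_ : (fun s => _) =
    fun s : CC R => (i == j)%:R + s * ((i == a) && (j == iota b))%:R).
    exact: affine_continuous.
  apply/funext => s; rewrite !mxE /u -mulrnA mulnb mulr_natr //.
move=> B nB.
have near0 : \forall s \near (0 : CC R)^', B (flag (G s)).
  apply: nbhs_dnbhs; apply: (cG 0 (flag (m:=m) (R:=R) @^-1` B)).
  by rewrite G0; exact: (pi_continuous nB).
(* Zero is not isolated in the complex numbers, so the neighbourhood [B] contains a point of the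
   curve with [s != 0]. *)
have [s [Bs s0]] : exists s, B (flag (G s)) /\ s != 0.
  exact: filter_ex (filterI near0 (nbhs_dnbhs_neq (0 : CC R))).
exists (flag (G s)); split=> //; apply/Y_flagP.
have [N' BN' sN'] := support_degenerate sN cab s0.
exists N' => //; apply: Bcong_sym; suff -> : gram (G s) = elim_mx (gram M) (iota b) (u s) by [].
rewrite -elim_mxE; last exact: antisym_gram.
by rewrite /gram /= trmx_mul !mulmxA.
Qed.

Lemma closure_subset_closure (T : topologicalType) (A B : set T) :
  A `<=` closure B -> closure A `<=` closure B.
Proof.
move=> /closure_subset; have <- // := (closure_id (closure B)).1.
exact: closed_closure.
Qed.

Lemma rk_le_closure_Y iota kappa : fpf_involution iota -> fpf_involution kappa ->
  rk_le iota kappa -> closure (Y R iota) `<=` closure (Y R kappa).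
Proof.
move=> fi fk le; apply: closure_subset_closure.
move: iota fi le; apply: rk_le_ind => // [|iota a b fi cab _ IH].
  exact: subset_closure.
apply: subset_trans (Y_rematch_closure cab) _.
exact: closure_subset_closure.
Qed.

Lemma closure_YP iota kappa : fpf_involution iota -> fpf_involution kappa ->
  closure (Y R iota) `<=` closure (Y R kappa) <-> opp_bruhat iota kappa.
Proof.
move=> fi fk; split=> [/(closure_Y_rk_le fi)/(opp_bruhatP fi fk) //|].
by move/(opp_bruhatP fi fk); apply: rk_le_closure_Y.
Qed.

Lemma Sp_orbit_closures_Y : Sp_orbit_closures R m =
  [set closure (Y R iota) | iota in [set iota : 'S_m | fpf_involution iota]].
Proof.
apply/seteqP; split=> [_ [x _ <-]|_ [iota /= fi <-]].
  have [iota fi Yx] := Y_cover x even_m; exists iota => //.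
  by have [M e] := flag_surj x; rewrite e in Yx *; rewrite (Sp_orbit_Y Yx).
have [M YM] := Y_nonempty R even_m fi.
by exists (flag M) => //; rewrite (Sp_orbit_Y YM).
Qed.

(** By [closure_YP] and antisymmetry, passing from [iota] to the closure of [Y iota] is an order
    isomorphism, so a set showing that [iota] is not basic carries over to closures. *)
Lemma basic_closure_Y (Z : set (Flag R m)) :
  basic (Sp_orbit_closures R m) subset Z ->
  exists2 iota : 'S_m,
    basic [set kappa : 'S_m | fpf_involution kappa] (@opp_bruhat m) iota &
    Z = closure (Y R iota).
Proof.
rewrite Sp_orbit_closures_Y => -[[iota /= fi <-] nglb].
exists iota => //; split=> // -[S [SF Slt [_ _ glb]]]; apply: nglb.
exists [set closure (Y R kappa) | kappa in S]; split.
- by move=> _ [kappa Sk <-]; exists kappa => //; apply: SF.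
- move=> _ [kappa Sk <-]; have fk : fpf_involution kappa := SF _ Sk.
  have [le ne] := Slt _ Sk; split; first exact/closure_YP.
  move=> e; apply: ne; apply: rk_le_anti => //; apply: closure_Y_rk_le => //;
  by rewrite e.
- split; first by exists iota.
    move=> _ [kappa Sk <-]; have fk : fpf_involution kappa := SF _ Sk.
    by apply/closure_YP => //; case: (Slt _ Sk).
  move=> _ [z /= fz <-] zS; apply/closure_YP => //; apply: glb => // kappa Sk.
  by apply/closure_YP => //; [exact: SF | apply: zS; exists kappa].
Qed.

End Closures.

Theorem theorem1p6 (R : realType) (n : nat) (n_ge1 : (1 <= n)%N) :
  (forall iota : 'S_(2 * n),
     basic [set kappa : 'S_(2 * n) | fpf_involution kappa]
           (@opp_bruhat (2 * n)) iota ->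
     A_all iota)
  /\
  (forall Z : set (Flag R (2 * n)),
     basic (Sp_orbit_closures R (2 * n)) subset Z ->
     exists2 iota : 'S_(2 * n), A_all iota & Z = closure (Y R iota)).
Proof.
split=> [iota|Z]; first exact: basic_A_all.
case/basic_closure_Y => [|iota biota eZ]; first by rewrite oddM.
by exists iota => //; apply: basic_A_all biota.
Qed.
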